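(* Let $A$ be a real $d\times d$ matrix, let $L$ be a Lévy process on $\mathbb{R}^d$ with Lévy measure $\nu$, and let $P_tf(x)=\mathbb{E}f(X_t^x)$, where $X^x$ solves $\mathrm{d}X_t^x=AX_t^x\,\mathrm{d}t+\mathrm{d}L_t$, $X_0^x=x\in\mathbb{R}^d$. Let $\alpha\in(0,2)$. If $$\nu(\mathrm{d}z)\ge\frac{c}{|z|^{\alpha+d}}1_{\{|z|<r\}}\,\mathrm{d}z$$ holds for some constants $c,r>0$, then there exists a constant $c'>0$ such that $$\|P_t\|_{1\to\infty}\le\frac{c'}{(1\wedge t)^{d/\alpha}},\qquad t>0.$$
   Context: A Lévy measure $\nu$ on $\mathbb{R}^d$ satisfies $\nu(\{0\})=0$ and $\int_{\mathbb{R}^d}(|z|^2\wedge1)\,\nu(\mathrm{d}z)<\infty$. With $b\in\mathbb{R}^d$ and $Q$ a non-negatively definite $d\times d$ matrix, $L$ is the Lévy process (started at $0$) generated by $$\mathscr{L}f=\langle b,\nabla f\rangle+\operatorname{Tr}(Q\nabla^2f)+\int_{\mathbb{R}^d}\{f(z+\cdot)-f-\langle\nabla f,z\rangle1_{\{|z|\le1\}}\}\,\nu(\mathrm{d}z),\qquad f\in C_b^2(\mathbb{R}^d).$$ The solution is $X_t^x=e^{At}x+\int_0^te^{A(t-s)}\,\mathrm{d}L_s$. $\|\cdot\|_{1\to\infty}$ is the operator norm from $L^1(\mathbb{R}^d;\mathrm{d}x)$ to $L^\infty(\mathbb{R}^d;\mathrm{d}x)$. *)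

(* Defs.v *)
From HB Require Import structures.
From mathcomp Require Import all_boot all_order all_algebra.
From mathcomp Require Import all_classical all_reals all_analysis measurable_realfun.

Set Implicit Arguments.
Unset Strict Implicit.
Unset Printing Implicit Defensive.

Import Order.TTheory GRing.Theory Num.Theory.
Import numFieldNormedType.Exports.

Local Open Scope classical_set_scope.
Local Open Scope ring_scope.

HB.instance Definition _ (R : realType) (m n : nat) :=
  Measurable.copy 'M[R]_(m, n) (g_sigma_algebraType (@open 'M[R]_(m, n))).

Section borel_matrix.
Context {R : realType} {m n : nat}.
Notation M := 'M[R]_(m, n).

Lemma measurable_mx_coord i j : measurable_fun [set: M] (fun A : M => A i j).
Proof.
apply: (measurability _ (RGenOpens.measurableE R)) => _ [_ [a [b ->]] <-].
rewrite setTI; apply: sub_sigma_algebra.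
have /continuousP := @coord_continuous R m n i j.
by apply; exact: interval_open.
Qed.

Lemma measurable_fun_mxP d (T : measurableType d) (f : T -> M) :
  (forall i j, measurable_fun setT (fun x => f x i j)) ->
  measurable_fun setT f.
Proof.
move=> mf; apply: (measurability (@open M)) => // _ [U Uo <-]; rewrite setTI.
pose B (q : 'M[rat]_(m, n)) (k : nat) : set M :=
  [set A | forall i j, `|ratr (q i j) - A i j| < k.+1%:R^-1].
have -> : f @^-1` U =
    \bigcup_(p : 'M[rat]_(m, n) * nat)
      (if `[< B p.1 p.2 `<=` U >] then f @^-1` B p.1 p.2 else set0).
  apply/seteqP; split => [x Ufx|x [[q k] _]/=]; last first.
    by case: asboolP => // BU; exact: BU.
  have /nbhs_ballP[e /= e0 eU] : nbhs (f x) U by exact: open_nbhs_nbhs.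
  have [k ke] : exists k : nat, k.+1%:R^-1 < e / 2.
    have [k _ kP] := near_infty_natSinv_lt (PosNum (divr_gt0 e0 (ltr0Sn R 1))).
    by exists k; apply: kP => /=.
  have qP i j : exists q : rat, `|ratr q - f x i j| < k.+1%:R^-1.
    have [|q] := @rat_in_itvoo R (f x i j - k.+1%:R^-1) (f x i j + k.+1%:R^-1).
      by rewrite ltrBlDr -addrA ltrDl addr_gt0// invr_gt0.
    rewrite in_itv/= => /andP[q1 q2]; exists q.
    by rewrite ltr_distl q1 q2.
  exists (\matrix_(i, j) xchoose (qP i j), k) => //=.
  set q := \matrix_(i, j) _.
  have Bqx : B q k (f x).
    by move=> i j; rewrite mxE; exact: (xchooseP (qP i j)).
  case: asboolP => // -[]; move=> A BA; apply: eU; split => // i j.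
  rewrite /ball/= (splitr e).
  rewrite (le_lt_trans (ler_distD (ratr (q i j)) _ _))// ltrD//.
    by rewrite distrC (lt_trans _ ke).
  by rewrite (lt_trans _ ke).
apply: countable_bigcupT_measurable; first exact: countableP.
move=> [q k]/=; case: ifPn => // _.
have -> : f @^-1` B q k = \bigcap_(p in [set: 'I_m * 'I_n])
    ((fun x => `|ratr (q p.1 p.2) - f x p.1 p.2|) @^-1` `]-oo, k.+1%:R^-1[).
  apply/seteqP; split => [x Bx [i j] _|x Bx i j] /=.
    by rewrite in_itv/=; exact: Bx.
  by have := Bx (i, j) I; rewrite /= in_itv.
apply: fin_bigcap_measurable => // -[i j] _ /=.
rewrite -[X in measurable X]setTI.
have : measurable_fun setT (fun x => `|ratr (q i j) - f x i j|).
  by apply: measurableT_comp => //; exact: measurable_funB.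
by apply => //; exact: measurable_itv.
Qed.

End borel_matrix.

Section lebesgue_measure_cV.
Context {R : realType}.

Definition consc d (p : R * 'cV[R]_d) : 'cV[R]_d.+1 :=
  \col_i (if unlift ord0 i is Some j then p.2 j 0 else p.1).

Fixpoint lebesgue_measure_cV (d : nat) : set 'cV[R]_d -> \bar R :=
  match d with
  | 0 => \d_(0 : 'cV[R]_0)
  | d'.+1 => pushforward (lebesgue_measure \x @lebesgue_measure_cV d')%E
                         (@consc d')
  end.

Definition unconsc d (v : 'cV[R]_d.+1) : R * 'cV[R]_d :=
  (v ord0 ord0, \col_i v (lift ord0 i) ord0).

Lemma conscK d : cancel (@consc d) (@unconsc d).
Proof.
move=> [x v]; rewrite /unconsc /consc mxE unlift_none; congr pair.
by apply/colP => i; rewrite !mxE liftK.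
Qed.

Lemma measurable_consc d : measurable_fun setT (@consc d).
Proof.
apply: measurable_fun_mxP => i j; under eq_fun do rewrite mxE.
case: unliftP => [k _|_]; last exact: measurable_fst.
apply: (@measurableT_comp _ _ _ _ _ _ (fun v : 'cV[R]_d => v k 0)) => //.
exact: measurable_mx_coord.
Qed.

Lemma measurable_unconsc d : measurable_fun setT (@unconsc d).
Proof.
apply/measurable_fun_pairP; split => /=.
  exact: measurable_mx_coord.
apply: measurable_fun_mxP => i j.
rewrite (_ : (fun x => _) = (fun v : 'cV[R]_d.+1 => v (lift ord0 i) ord0)).
  exact: measurable_mx_coord.
by apply/funext => x /=; rewrite mxE.
Qed.

Lemma unconscK d : cancel (@unconsc d) (@consc d).
Proof.
move=> v; rewrite /unconsc /consc; apply/colP => i; rewrite !mxE.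
by case: unliftP => [k ->|->]; rewrite ?mxE.
Qed.

Section step.
Context {d : nat} (m : {sigma_finite_measure set 'cV[R]_d -> \bar R}).

Definition product_step : set 'cV[R]_d.+1 -> \bar R :=
  pushforward (lebesgue_measure \x m)%E (@consc d).

HB.instance Definition _ := Measure.copy product_step
  (@measure_function_pushforward__canonical__measure_function_Measure _ _ _ _ _
     (lebesgue_measure \x m)%E _ (@measurable_consc d)).

Let product_step_sf : sigma_finite setT product_step.
Proof.
have /sigma_finiteP[F [TF ndF Foo]] := sigma_finiteT (@lebesgue_measure R).
have /sigma_finiteP[G [TG ndG Goo]] := sigma_finiteT m.
exists (fun n => @unconsc d @^-1` (F n `*` G n)).
  rewrite -preimage_bigcup (_ : \bigcup_n _ = setT) ?preimage_setT//.
  rewrite -setXTT TF TG predeqE => -[x y]; split.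
    by move=> [n _ []/= ? ?]; split; exists n.
  move=> [/= [n _ Fnx] [k _ Gky]]; exists (maxn n k) => //; split.
  - by move: x Fnx; exact/subsetPset/ndF/leq_maxl.
  - by move: y Gky; exact/subsetPset/ndG/leq_maxr.
move=> n; have [mF Foon] := Foo n; have [mG Goon] := Goo n; split.
  rewrite -[X in measurable X]setTI; apply: measurable_unconsc => //.
  exact: measurableX.
rewrite /product_step /pushforward -comp_preimage (_ : _ \o _ = id); last first.
  by apply/funext => x; exact: conscK.
by rewrite preimage_id product_measure1E// lte_mul_pinfty// ge0_fin_numE.
Qed.

HB.instance Definition _ := Measure_isSigmaFinite.Build _ _ _
  product_step product_step_sf.

Lemma lebesgue_measure_cV_step :
  exists p : {sigma_finite_measure set 'cV[R]_d.+1 -> \bar R},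
    pushforward (lebesgue_measure \x m)%E (@consc d) = p.
Proof. by exists product_step. Qed.

End step.

Lemma lebesgue_measure_cV_spec d :
  exists m : {sigma_finite_measure set 'cV[R]_d -> \bar R},
    @lebesgue_measure_cV d = m.
Proof.
elim: d => [|d [m /= ->]]; last exact: lebesgue_measure_cV_step.
by exists (\d_(0 : 'cV[R]_0) : {sigma_finite_measure set _ -> \bar R}).
Qed.

Let leb0 d : lebesgue_measure_cV (@set0 'cV[R]_d) = 0%E.
Proof. by have [m ->] := lebesgue_measure_cV_spec d; exact: measure0. Qed.

Let leb_ge0 d (A : set 'cV[R]_d) : (0 <= lebesgue_measure_cV A)%E.
Proof. by have [m ->] := lebesgue_measure_cV_spec d; exact: measure_ge0. Qed.

Let leb_semi_sigma_additive d : semi_sigma_additive (@lebesgue_measure_cV d).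
Proof.
have [m ->] := lebesgue_measure_cV_spec d.
exact: measure_semi_sigma_additive.
Qed.

HB.instance Definition _ d := isMeasure.Build _ _ _ (@lebesgue_measure_cV d)
  (leb0 d) (@leb_ge0 d) (@leb_semi_sigma_additive d).

Let leb_sigma_finite d : sigma_finite setT (@lebesgue_measure_cV d).
Proof.
by have [m ->] := lebesgue_measure_cV_spec d; exact: sigma_finiteT.
Qed.

HB.instance Definition _ d := Measure_isSigmaFinite.Build _ _ _
  (@lebesgue_measure_cV d) (@leb_sigma_finite d).

End lebesgue_measure_cV.

Section calculus.
Context {R : realType} {d : nat}.
Implicit Types (f : 'cV[R]_d -> R) (x z u v : 'cV[R]_d) (Q : 'M[R]_d).

Definition dotp u v : R := \sum_i u i 0 * v i 0.

(* The library norm `|z| on 'cV[R]_d is the sup norm. *)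
Definition enorm z : R := Num.sqrt (dotp z z).

Definition partial (i : 'I_d) f : 'cV[R]_d -> R :=
  fun x => 'D_(delta_mx i 0) f x.

Definition gradient f x : 'cV[R]_d := \col_i partial i f x.

Definition hessian f x : 'M[R]_d := \matrix_(i, j) partial i (partial j f) x.

Definition partial_derivable f := forall x i, derivable f x (delta_mx i 0).

Definition Cb f := continuous f /\ bounded_fun f.

Definition Cb2 f :=
  [/\ Cb f,
      partial_derivable f /\ (forall i, Cb (partial i f)) &
      forall j, partial_derivable (partial j f) /\
                (forall i, Cb (partial i (partial j f)))].

Definition nonneg_definite Q := Q^T = Q /\ forall u, 0 <= dotp u (Q *m u).

Definition levy_measure (nu : {measure set 'cV[R]_d -> \bar R}) :=
  nu [set 0] = 0%E /\
  (\int[nu]_z (Num.min (enorm z ^+ 2) 1)%:E < +oo)%E.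

Definition levy_operator (b : 'cV[R]_d) Q
    (nu : {measure set 'cV[R]_d -> \bar R}) f x : R :=
  dotp b (gradient f x) + \tr (Q *m hessian f x) +
  \int[nu]_z (f (z + x) - f x -
              dotp (gradient f x) z * (enorm z <= 1)%R%:R).

End calculus.

Section processes.
Context {R : realType} {d : nat} {d0 : measure_display}.
Context {Omega : measurableType d0} (P : probability Omega R).
Implicit Types (L X : R -> Omega -> 'cV[R]_d).

(* Processes are indexed by all of R, but only their values at nonnegative
   times matter. *)
Definition cadlag (p : R -> 'cV[R]_d) := forall t, 0 <= t ->
  p s @[s --> t^'+] --> p t /\ (0 < t -> cvg (p s @[s --> t^'-])).

Definition independent_increments L :=
  forall (n : nat) (t : nat -> R), 0 <= t 0%N ->
  (forall i, t i <= t i.+1) ->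
  forall B : nat -> set 'cV[R]_d, (forall i, measurable (B i)) ->
  P [set w | forall i, (i < n)%N -> B i (L (t i.+1) w - L (t i) w)] =
  (\prod_(i < n) P [set w | B i (L (t i.+1) w - L (t i) w)%R])%E.

Definition stationary_increments L :=
  forall s h, 0 <= s -> 0 <= h ->
  forall B : set 'cV[R]_d, measurable B ->
  P [set w | B (L (s + h) w - L s w)] = P [set w | B (L h w - L 0 w)].

Definition stochastically_continuous L :=
  forall t e, 0 <= t -> 0 < e ->
  P [set w | e < enorm (L s w - L t w)]
    @[s --> within [set s | 0 <= s] (nbhs t)] --> 0%E.

Record levy_process L : Prop := LevyProcess {
  levy_measurable : forall t, 0 <= t -> measurable_fun setT (L t) ;
  levy_start : {ae P, forall w, L 0 w = 0} ;
  levy_independent : independent_increments L ;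
  levy_stationary : stationary_increments L ;
  levy_continuous : stochastically_continuous L ;
  levy_cadlag : {ae P, forall w, cadlag (L ^~ w)} }.

(* For f in C_b^2 the difference quotients need not converge uniformly in x,
   hence the pointwise limit. *)
Definition generated_by L (G : ('cV[R]_d -> R) -> 'cV[R]_d -> R) :=
  forall f, Cb2 f -> forall x,
  (\int[P]_w f (x + L t w) - f x) / t @[t --> 0^'+] --> G f x.

(* dX = A X dt + dL, X_0 = x. The noise is additive, so the equation is solved
   path by path and its integral form involves no stochastic integral; the
   drift integral is proper because the paths are cadlag. *)
Record ou_solution (A : 'M[R]_d) L (x : 'cV[R]_d) X : Prop := OUSolution {
  ou_measurable : forall t, 0 <= t -> measurable_fun setT (X t) ;
  ou_cadlag : {ae P, forall w, cadlag (X ^~ w)} ;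
  ou_equation : {ae P, forall w, forall t, 0 <= t ->
    X t w = x +
      (\col_i \int[lebesgue_measure]_(s in `[0, t]) ((A *m X s w) i 0)) +
      L t w} }.

Definition ou_semigroup (X : 'cV[R]_d -> R -> Omega -> 'cV[R]_d) (t : R)
    (f : 'cV[R]_d -> R) (x : 'cV[R]_d) : \bar R :=
  'E_P[fun w => f (X x t w)].

End processes.

(* Operator norm from L^1(R^d) to L^oo(R^d). T takes extended real values
   because T f is not known beforehand to be finite when f is in L^1; an
   expectation of the form +oo - oo has value -oo, so that it can only make
   the norm larger. *)
Definition norm_1_oo (R : realType) (d : nat)
    (T : ('cV[R]_d -> R) -> 'cV[R]_d -> \bar R) : \bar R :=
  (ereal_sup [set 'N[@lebesgue_measure_cV R d]_+oo [T f] | f in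
    [set f : 'cV[R]_d -> R | measurable_fun setT f /\
       'N[@lebesgue_measure_cV R d]_1 [EFin \o f] <= 1]])%E.

(* Main.v *)
(* Write [m = min(1, t)]. The density of [X_t^x] is controlled by its
   characteristic function, which is bounded through the generator and the
   independence of the increments of [L], without the Levy-Ito decomposition.

   Applying the generator to [cos(<xi, .>)] and [sin(<xi, .>)] gives the
   derivative at 0 of the characteristic function of [L_h]; as increments are
   independent and stationary its squared modulus is multiplicative in [h],
   hence at most [exp(h (c2 - c1 |xi|^alpha))], where the lower bound on the
   symbol comes from the [nu]-mass of a box of side about [1 / |xi|] on which
   [<xi, z>] lies in [1/2, 3/2].

   The equation is solved by the implicit Euler scheme: pathwise, [<xi, X_t>]
   is the limit of a constant plus [sum_k <eta_k, L_((k+1)h) - L_(kh)>] with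
   [eta_k = (1 - h A^T)^-(n - k) xi], and over the last unit of time [|eta_k|]
   is comparable to [|xi|]. Only the increments of that period are used, the
   other factors being at most 1, so
   [|E cos(<xi, X_t> - y)| <= K exp(- k m |xi|^alpha)] for all [t > 0].

   For theta in [-1/(dN), 1/(dN)]^d, the Fejer-type sum
   [N^-d |sum_(k in [0, N)^d) exp(i <k, theta>)|^2] is at least [N^d / 4]; its
   expectation at [theta = X_t - y] is at most
   [N^-d sum_(k, l) K exp(- k m |k - l|^alpha) <= C m^(-d/alpha)]. So the law of
   [X_t] gives every cube of side [1/(dN)] at most [C m^(-d/alpha)] times its
   Lebesgue measure; approximating Borel sets by finite-level dyadic sets
   extends this to all Borel sets, and the bound on [E f(X_t)] follows. *)
Require Import Defs.
From HB Require Import structures.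
From mathcomp Require Import all_boot all_order all_algebra.
From mathcomp Require Import all_classical all_reals all_analysis.
From mathcomp Require Import measurable_realfun.
From mathcomp Require Import ring lra zify.

Set Implicit Arguments.
Unset Strict Implicit.
Unset Printing Implicit Defensive.

Import Order.TTheory GRing.Theory Num.Theory.
Import numFieldNormedType.Exports.

Local Open Scope classical_set_scope.
Local Open Scope ring_scope.

(** * Bounded measurable functions and independence *)

Definition bmeas d (T : measurableType d) (R : realType) (f : T -> R) :=
  measurable_fun setT f /\ exists M, forall x, `|f x| <= M.

Section bmeas_closure.
Context d (T : measurableType d) (R : realType).
Implicit Types f g : T -> R.

Lemma bmeas_cst (c : R) : bmeas (fun _ : T => c).
Proof. by split => //; exists `|c|. Qed.

Lemma bmeasD f g : bmeas f -> bmeas g -> bmeas (fun x => f x + g x).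
Proof.
move=> [mf [M fM]] [mg [N gN]]; split; first exact: measurable_funD.
by exists (M + N) => x; rewrite (le_trans (ler_normD _ _))// lerD.
Qed.

Lemma bmeasM f g : bmeas f -> bmeas g -> bmeas (fun x => f x * g x).
Proof.
move=> [mf [M fM]] [mg [N gN]]; split; first exact: measurable_funM.
by exists (M * N) => x; rewrite normrM ler_pM.
Qed.

Lemma bmeasZ c f : bmeas f -> bmeas (fun x => c * f x).
Proof. by apply: bmeasM; exact: bmeas_cst. Qed.

Lemma bmeasB f g : bmeas f -> bmeas g -> bmeas (fun x => f x - g x).
Proof.
move=> bf bg; under eq_fun do rewrite -mulN1r.
by apply: bmeasD => //; exact: bmeasZ.
Qed.

Lemma bmeas_sum I (s : seq I) (p : pred I) (F : I -> T -> R) :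
  (forall i, bmeas (F i)) -> bmeas (fun x => \sum_(i <- s | p i) F i x).
Proof.
move=> bF; elim: s => [|i s ih].
  by under eq_fun do rewrite big_nil; exact: bmeas_cst.
by case pi: (p i); under eq_fun do rewrite big_cons pi; [exact: bmeasD|].
Qed.

Lemma bmeas_prod I (s : seq I) (p : pred I) (F : I -> T -> R) :
  (forall i, bmeas (F i)) -> bmeas (fun x => \prod_(i <- s | p i) F i x).
Proof.
move=> bF; elim: s => [|i s ih].
  by under eq_fun do rewrite big_nil; exact: bmeas_cst.
by case pi: (p i); under eq_fun do rewrite big_cons pi; [exact: bmeasM|].
Qed.

Lemma bmeas_indic (B : set T) : measurable B -> bmeas (\1_B : T -> R).
Proof.
move=> mB; split; first exact: measurable_indic.
by exists 1 => x; rewrite indicE; case: (x \in B); rewrite ?normr1 ?normr0.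
Qed.

Lemma bmeas_comp d' (T' : measurableType d') (X : T' -> T) f :
  measurable_fun setT X -> bmeas f -> bmeas (fun w => f (X w)).
Proof.
by move=> mX [mf [M fM]]; split; [exact: measurableT_comp|exists M].
Qed.

Lemma bmeas_cos f : measurable_fun setT f -> bmeas (fun x => cos (f x)).
Proof.
move=> mf; split; last first.
  by exists 1 => x; rewrite ler_norml cos_geN1 cos_le1.
by apply: measurableT_comp => //; apply: continuous_measurable_fun => x;
  exact: continuous_cos.
Qed.

Lemma bmeas_sin f : measurable_fun setT f -> bmeas (fun x => sin (f x)).
Proof.
move=> mf; split; last first.
  by exists 1 => x; rewrite ler_norml sin_geN1 sin_le1.
by apply: measurableT_comp => //; apply: continuous_measurable_fun => x;
  exact: continuous_sin.
Qed.

(* Floor approximation [f_e = sum_i (i e - K) 1_{i e - K <= f < (i + 1) e - K}]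
   is uniformly within [e] of [f]. *)
Lemma bmeas_ind (Phi : (T -> R) -> R) (M : R) :
  (forall f g, bmeas f -> bmeas g -> Phi (fun x => f x + g x) = Phi f + Phi g) ->
  (forall c f, bmeas f -> Phi (fun x => c * f x) = c * Phi f) ->
  (forall f e, bmeas f -> (forall x, `|f x| <= e) -> `|Phi f| <= M * e) ->
  (forall B, measurable B -> Phi \1_B = 0) ->
  forall f, bmeas f -> Phi f = 0.
Proof.
move=> PD PZ PM PB f bf; have [mf [K fK]] := bf.
have M0 : 0 <= M.
  rewrite -[M]mulr1; apply: le_trans (PM (fun=> 0) 1 _ _) => //.
    exact: bmeas_cst.
  by move=> x; rewrite normr0.
have Psum n (c : nat -> R) (B : nat -> set T) : (forall i, measurable (B i)) ->
    Phi (fun x => \sum_(i < n) c i * \1_(B i) x) = 0.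
  move=> mB; elim: n => [|n ih].
    under eq_fun do rewrite big_ord0 -[0](mul0r 0).
    by rewrite PZ ?mul0r//; exact: bmeas_cst.
  under eq_fun do rewrite big_ord_recr/=.
  rewrite PD ?ih ?PZ ?PB ?mulr0 ?addr0//; [exact: bmeas_indic| |].
    by apply: bmeas_sum => i; apply: bmeasZ; exact: bmeas_indic.
  by apply: bmeasZ; exact: bmeas_indic.
suff H e : 0 < e -> `|Phi f| <= M * e.
  apply/eqP; rewrite -normr_eq0 eq_le normr_ge0 andbT; apply/ler_addgt0Pl => e e0.
  rewrite addr0 (le_trans (H (e / (M + 1)) _))// ?divr_gt0 ?ltr_wpDl//.
  by rewrite mulrA ler_pdivrMr ?ltr_wpDl//; nra.
move=> e0.
(* More than [2 K / e] levels of height [e] starting at [- K] cover the range of [f]; strictness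
   includes the value [K] itself. *)
have [n Hn] : exists n : nat, (K + K) / e < n%:R.
  exists (Num.bound `|(K + K) / e|).
  by rewrite (le_lt_trans (ler_norm _))// archi_boundP.
pose B i := f @^-1` `[i%:R * e - K, i.+1%:R * e - K[%classic.
have mB i : measurable (B i).
  by rewrite /B -[X in measurable X]setTI; exact: mf.
pose fe x := \sum_(i < n) (i%:R * e - K) * \1_(B i) x.
have bfe : bmeas fe by apply: bmeas_sum => i; apply: bmeasZ; exact: bmeas_indic.
have -> : Phi f = Phi (fun x => f x - fe x).
  rewrite -[RHS]addr0 -[X in _ + X](Psum n (fun i => i%:R * e - K) _ mB).
  rewrite -PD//; last exact: bmeasB.
  by congr Phi; apply/funext => x; rewrite subrK.
apply: PM => [|x]; first exact: bmeasB.
have := fK x; rewrite ler_norml => /andP[f1 f2].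
have y0 : 0 <= (f x + K) / e by apply: divr_ge0; lra.
have /andP[t1 t2] := truncn_itv y0.
set j := Num.trunc _ in t1 t2.
have jn : (j < n)%N.
  rewrite -(ltr_nat R) (le_lt_trans t1)// (le_lt_trans _ Hn)// ler_pM2r ?invr_gt0//; lra.
move: t1 t2; rewrite ler_pdivlMr// ltr_pdivrMr// => t1 t2.
rewrite /fe (bigD1 (Ordinal jn))//= big1 ?addr0; last first.
  move=> i; rewrite -val_eqE/= => ij; rewrite indicE memNset ?mulr0//.
  rewrite /B/= in_itv/= => /andP[g1 g2]; move: ij; apply/negP; rewrite negbK.
  have ij1 : (i < j.+1)%N by rewrite -(ltr_nat R) -(ltr_pM2r e0); lra.
  have ij2 : (j < i.+1)%N by rewrite -(ltr_nat R) -(ltr_pM2r e0); lra.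
  by rewrite eqn_leq -ltnS ij1 -ltnS ij2.
rewrite indicE mem_set ?mulr1; last by rewrite /B/= in_itv/=; apply/andP; split; lra.
move: t2; rewrite -natr1 mulrDl mul1r => t2.
by rewrite ger0_norm; lra.
Qed.

End bmeas_closure.

Section bmeas_integral.
Context d (T : measurableType d) (R : realType) (P : probability T R).
Implicit Types f g : T -> R.

Lemma bmeas_integrable f : bmeas f -> P.-integrable setT (EFin \o f).
Proof.
move=> [mf [M fM]]; apply: measurable_bounded_integrable => //.
  by have := @probability_setT _ _ _ P => /= ->; rewrite ltry.
exists M; split; first exact: num_real.
by move=> N MN x _ /=; rewrite (le_trans (fM x))// ltW.
Qed.

Lemma bintD f g : bmeas f -> bmeas g ->
  \int[P]_x (f x + g x) = \int[P]_x f x + \int[P]_x g x.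
Proof. by move=> bf bg; rewrite RintegralD//; exact: bmeas_integrable. Qed.

Lemma bintB f g : bmeas f -> bmeas g ->
  \int[P]_x (f x - g x) = \int[P]_x f x - \int[P]_x g x.
Proof. by move=> bf bg; rewrite RintegralB//; exact: bmeas_integrable. Qed.

Lemma bintZ c f : bmeas f -> \int[P]_x (c * f x) = c * \int[P]_x f x.
Proof. by move=> bf; rewrite RintegralZl//; exact: bmeas_integrable. Qed.

Lemma bint_sum I (s : seq I) (p : pred I) (F : I -> T -> R) :
  (forall i, bmeas (F i)) ->
  \int[P]_x (\sum_(i <- s | p i) F i x) = \sum_(i <- s | p i) \int[P]_x F i x.
Proof.
move=> bF; elim: s => [|i s ih].
  rewrite big_nil; under eq_Rintegral do rewrite big_nil.
  by rewrite Rintegral_cst// mul0r.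
rewrite big_cons; case pi: (p i); under eq_Rintegral do rewrite big_cons pi; rewrite ?ih//.
by rewrite bintD ?ih//; exact: bmeas_sum.
Qed.

Lemma bint_cst (c : R) : \int[P]_x c = c.
Proof.
rewrite Rintegral_cst//.
by have := @probability_setT _ _ _ P => /= ->; rewrite mulr1.
Qed.

Lemma bint_le f g : bmeas f -> bmeas g -> (forall x, f x <= g x) ->
  \int[P]_x f x <= \int[P]_x g x.
Proof. by move=> bf bg fg; apply: le_Rintegral => //; exact: bmeas_integrable. Qed.

Lemma bint_norm f e : bmeas f -> (forall x, `|f x| <= e) ->
  `|\int[P]_x f x| <= e.
Proof.
move=> bf fe; rewrite ler_norml; apply/andP; split.
  rewrite -(bint_cst (- e)); apply: bint_le => //; first exact: bmeas_cst.
  by move=> x; have := fe x; rewrite ler_norml => /andP[].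
rewrite -[leRHS](bint_cst e); apply: bint_le => //; first exact: bmeas_cst.
by move=> x; have := fe x; rewrite ler_norml => /andP[].
Qed.

Lemma bint_indic (B : set T) : measurable B -> \int[P]_x \1_B x = fine (P B).
Proof. by move=> mB; rewrite /Rintegral integral_indic// setIT. Qed.

End bmeas_integral.

Section independence.
Context d (T : measurableType d) (R : realType) (P : probability T R).
Context d' (T' : measurableType d').

(** One product formula for all [n] variables suffices: events on fewer variables arise by taking
    [B i = setT]. *)
Definition indep_seq n (D : nat -> T -> T') :=
  forall B : nat -> set T', (forall i, measurable (B i)) ->
  P [set w | forall i, (i < n)%N -> B i (D i w)] =
  (\prod_(i < n) P [set w | B i (D i w)])%E.

(** Indicators are exchanged for general functions one factor at a time. The induction is on the
    number [m] of leading factors that are already general; each exchange is an application of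
    [bmeas_ind]. *)
Lemma indep_prod n (D : nat -> T -> T') : (forall i, measurable_fun setT (D i)) ->
  indep_seq n D -> forall g : nat -> T' -> R, (forall i, bmeas (g i)) ->
  \int[P]_w (\prod_(i < n) g i (D i w)) = \prod_(i < n) \int[P]_w g i (D i w).
Proof.
move=> mD iD.
suff H m (g : nat -> T' -> R) (B : nat -> set T') : (m <= n)%N ->
    (forall i, measurable (B i)) -> (forall i, bmeas (g i)) ->
    (forall i, (m <= i)%N -> g i = \1_(B i)) ->
    \int[P]_w (\prod_(i < n) g i (D i w)) = \prod_(i < n) \int[P]_w g i (D i w).
  (* The claim [H] asks for indicators at every index from [m] on, also beyond [n], hence the
     padding. *)
  move=> g bg; pose g' i := if (i < n)%N then g i else \1_setT.
  have {}H := H n g' (fun=> setT) (leqnn n) _ _ _.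
  rewrite (@eq_Rintegral _ _ _ P setT (fun w => \prod_(i < n) g' i (D i w))); last first.
    by move=> w _; apply: eq_bigr => i _; rewrite /g' ltn_ord.
  rewrite H//; first by apply: eq_bigr => i _; rewrite /g' ltn_ord.
    by move=> i; rewrite /g'; case: ifP => // _; exact: bmeas_indic.
  by move=> i; rewrite /g' ltnNge => ->.
elim: m g B => [|m ih] g B.
  move=> _ mB _ gB.
  have mDB i : measurable [set w | B i (D i w)].
    by rewrite -[X in measurable X]setTI; exact: mD.
  have mA : measurable [set w | forall i, (i < n)%N -> B i (D i w)].
    rewrite [X in measurable X](_ : _ =
        \bigcap_(i in [set i | (i < n)%N]) [set w | B i (D i w)]).
      by apply: bigcap_measurableType.
    by apply/seteqP; split => w /= h i; exact: h.
  rewrite (@eq_Rintegral _ _ _ P setT (\1_[set w | forall i, (i < n)%N -> B i (D i w)])).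
    rewrite bint_indic// iD//.
    transitivity (\prod_(i < n) fine (P [set w | B i (D i w)])).
      elim: n {iD mA} => [|n ihn]; first by rewrite !big_ord0.
      rewrite !big_ord_recr/= -ihn fineM//; last exact: fin_num_measure.
      rewrite ge0_fin_numE ?prode_ge0//.
      elim: n {ihn} => [|n ihn]; first by rewrite big_ord0 ltry.
      by rewrite big_ord_recr/= lte_mul_pinfty ?prode_ge0//;
        [rewrite ge0_fin_numE ?prode_ge0|rewrite (le_lt_trans (probability_le1 _ _)) ?ltry].
    apply: eq_bigr => i _; rewrite -bint_indic//.
    by apply: eq_Rintegral => w _; rewrite gB// !indicE.
  move=> w _; rewrite indicE; case: (boolP (w \in _)).
    by move=> /set_mem/= h; apply: big1 => i _; rewrite gB// indicE mem_set//; exact: h.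
  move=> /negP h; apply/eqP; apply/prodf_eq0.
  have /existsNP[i /not_implyP[ltin nB]] : ~ (forall i, (i < n)%N -> B i (D i w)).
    by move=> h'; apply: h; rewrite inE.
  by exists (Ordinal ltin) => //=; rewrite gB// indicE memNset.
move=> mn mB bg gB.
pose o := Ordinal mn.
pose H w := \prod_(i < n | i != o) g i (D i w).
have bH : bmeas H by apply: bmeas_prod => i; exact: bmeas_comp.
have bgm f : bmeas f -> bmeas (fun w => f (D m w)) by exact: bmeas_comp.
have bgmH f : bmeas f -> bmeas (fun w => f (D m w) * H w).
  by move=> bf; apply: bmeasM => //; exact: bgm.
pose h := \prod_(i < n | i != o) \int[P]_w g i (D i w).
(* The difference of the two sides as a linear functional of the factor at [m]; on indicators it
   vanishes by the induction hypothesis. *)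
pose Phi (f : T' -> R) := \int[P]_w (f (D m w) * H w) - (\int[P]_w f (D m w)) * h.
rewrite (bigD1 o)//= (@eq_Rintegral _ _ _ P setT (fun w => g m (D m w) * H w)); last first.
  by move=> w _; rewrite (bigD1 o).
apply/eqP; rewrite -subr_eq0; apply/eqP; rewrite -/(Phi (g m)).
have [_ [K HK]] := bH.
apply: (@bmeas_ind _ _ _ Phi (K + `|h|)) => //.
- move=> f f' bf bf'; rewrite /Phi; under eq_Rintegral do rewrite mulrDl.
  by rewrite !bintD//; first [exact: bgmH|exact: bgm|ring].
- move=> c f bf; rewrite /Phi; under eq_Rintegral do rewrite -mulrA.
  by rewrite !bintZ//; first [exact: bgmH|exact: bgm|ring].
- move=> f e bf fe; rewrite /Phi (le_trans (ler_normB _ _))// mulrDl lerD//.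
    apply: bint_norm => [|w]; first by apply: bmeasM => //; exact: bgm.
    by rewrite normrM mulrC ler_pM.
  by rewrite normrM mulrC ler_wpM2l// bint_norm//; exact: bgm.
- move=> B' mB'; rewrite /Phi; apply/eqP; rewrite subr_eq0; apply/eqP.
  pose g' i := if i == m then (\1_B' : T' -> R) else g i.
  have := ih g' (fun i => if i == m then B' else B i) (ltnW mn) _ _ _.
  rewrite [in X in _ -> X](@eq_Rintegral _ _ _ P setT (fun w => \prod_(i < n) g' i (D i w))); last first.
    move=> w _; rewrite (bigD1 o)//= {1}/g' eqxx; congr (_ * _).
    by apply: eq_bigr => i; rewrite /g' -val_eqE/= => /negbTE ->.
  move=> ->; last 3 first.
  + by move=> i; case: ifP.
  + by move=> i; rewrite /g'; case: ifP => // _; exact: bmeas_indic.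
  + move=> i mi; rewrite /g'; case: eqVneq => // im; apply: gB.
    by rewrite ltn_neqAle eq_sym im.
  rewrite (bigD1 o)//= {1}/g' eqxx; congr (_ * _).
  by apply: eq_bigr => i; rewrite /g' -val_eqE/= => /negbTE ->.
Qed.

End independence.

(** * Characteristic functions *)

Section charf.
Context d (T : measurableType d) (R : realType) (P : probability T R).
Implicit Types Y : T -> R.

(* squared modulus of the characteristic function of [Y] at 1 *)
Definition cf2 Y : R := (\int[P]_w cos (Y w)) ^+ 2 + (\int[P]_w sin (Y w)) ^+ 2.

Lemma cf2_ge0 Y : 0 <= cf2 Y.
Proof. by rewrite addr_ge0// sqr_ge0. Qed.

Lemma bint_rot (a b : R) Y : measurable_fun setT Y ->
  \int[P]_w (a * cos (Y w) + b * sin (Y w)) =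
  a * \int[P]_w cos (Y w) + b * \int[P]_w sin (Y w).
Proof.
move=> mY; rewrite bintD ?bintZ//.
- exact: bmeas_sin.
- exact: bmeas_cos.
- by apply: bmeasZ; exact: bmeas_cos.
- by apply: bmeasZ; exact: bmeas_sin.
Qed.

Lemma bmeas_rot (a b : R) Y : measurable_fun setT Y ->
  bmeas (fun w => a * cos (Y w) + b * sin (Y w)).
Proof.
by move=> mY; apply: bmeasD; apply: bmeasZ; [exact: bmeas_cos|exact: bmeas_sin].
Qed.

(** With [C] and [S] the two integrals, integrate the pointwise bound
    [C cos Y + S sin Y <= (C^2 + S^2 + 1) / 2], whose left side has integral [C^2 + S^2]. *)
Lemma cf2_le1 Y : measurable_fun setT Y -> cf2 Y <= 1.
Proof.
move=> mY; set C := \int[P]_w cos (Y w); set S := \int[P]_w sin (Y w).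
have : C * C + S * S <= (cf2 Y + 1) / 2.
  rewrite -bint_rot//= -(bint_cst P ((cf2 Y + 1) / 2)).
  apply: bint_le; [exact: bmeas_rot|exact: bmeas_cst|move=> w].
  rewrite /cf2 -/C -/S; have := cos2Dsin2 (Y w).
  move: (cos _) (sin _) => c s cs.
  have := sqr_ge0 (C - c); have := sqr_ge0 (S - s); nra.
by rewrite /cf2 -/C -/S; lra.
Qed.

(** Cauchy-Schwarz in the plane against the unit vector [(cos c, sin c)]. A deterministic phase
    therefore never matters for the upper bounds. *)
Lemma cf2_cosB Y (c : R) : measurable_fun setT Y ->
  (\int[P]_w cos (Y w - c)) ^+ 2 <= cf2 Y.
Proof.
move=> mY; under eq_Rintegral do rewrite cosB mulrC [X in _ + X]mulrC.
rewrite bint_rot// /cf2; move: (\int[P]_w _) (\int[P]_w _) => C S.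
have := cos2Dsin2 c; move: (cos c) (sin c) => u v uv.
have := sqr_ge0 (v * S - u * C).
rewrite -[X in _ -> _ <= X]mul1r -uv; nra.
Qed.

Lemma eq_cf2 Y Z : Y =1 Z -> cf2 Y = cf2 Z.
Proof. by move=> /funext ->. Qed.

Context d' (T' : measurableType d').

(** Multiplicativity of the characteristic function, written in real and imaginary parts. The
    induction keeps arbitrary test functions of the variables not yet absorbed, so that the next one
    can be split off by the addition formulas. *)
Lemma cf2_indep n (D : nat -> T -> T') (th : nat -> T' -> R) :
  (forall i, measurable_fun setT (D i)) ->
  (forall i, measurable_fun setT (th i)) ->
  indep_seq P n D ->
  cf2 (fun w => \sum_(i < n) th i (D i w)) = \prod_(i < n) cf2 (fun w => th i (D i w)).
Proof.
move=> mD mth iD; pose S m w := \sum_(i < m) th i (D i w).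
have mthD i : measurable_fun setT (fun w => th i (D i w)).
  exact: measurableT_comp.
have mS m : measurable_fun setT (S m) by exact: measurable_sum.
suff H m : (m <= n)%N -> exists a b,
    a ^+ 2 + b ^+ 2 = \prod_(i < m) cf2 (fun w => th i (D i w)) /\
    forall g : nat -> T' -> R, (forall i, bmeas (g i)) ->
     \int[P]_w (cos (S m w) * \prod_(m <= i < n) g i (D i w)) =
     a * \prod_(m <= i < n) \int[P]_w g i (D i w) /\
     \int[P]_w (sin (S m w) * \prod_(m <= i < n) g i (D i w)) =
     b * \prod_(m <= i < n) \int[P]_w g i (D i w).
  have [a [b [<- h]]] := H n (leqnn n).
  have [/= ha hb] := h (fun i _ => 1) (fun=> bmeas_cst _ 1).
  move: ha hb; rewrite !big_geq// !mulr1 /cf2 => <- <-.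
  by congr (_ ^+ 2 + _ ^+ 2); apply: eq_Rintegral => w _; rewrite mulr1.
elim: m => [_|m ih mn].
  exists 1, 0; split; first by rewrite big_ord0 expr1n expr0n addr0.
  move=> g bg; have := indep_prod mD iD bg.
  rewrite -(big_mkord xpredT (fun i => \int[P]_w g i (D i w))) => <-.
  rewrite mul1r mul0r; split.
    by apply: eq_Rintegral => w _; rewrite /S big_ord0 cos0 mul1r big_mkord.
  rewrite -[RHS](bint_cst P); apply: eq_Rintegral => w _.
  by rewrite /S big_ord0 sin0 mul0r.
have [a [b [ab h]]] := ih (ltnW mn).
pose C := \int[P]_w cos (th m (D m w)); pose s := \int[P]_w sin (th m (D m w)).
(* Real and imaginary parts of [(a + i b) (C + i s)]. *)
exists (a * C - b * s), (b * C + a * s); split.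
  by rewrite big_ord_recr/= -ab /cf2 -/C -/s; ring.
move=> g bg.
(* The cosine and sine of the new angle become the test functions at index [m], to which the
   induction hypothesis applies. *)
pose gc i := if i == m then (fun x => cos (th m x)) else g i.
pose gs i := if i == m then (fun x => sin (th m x)) else g i.
have bgc i : bmeas (gc i).
  by rewrite /gc; case: ifP => // _; exact: bmeas_cos.
have bgs i : bmeas (gs i).
  by rewrite /gs; case: ifP => // _; exact: bmeas_sin.
have bD i f : bmeas f -> bmeas (fun w => f (D i w)) by exact: bmeas_comp.
have Ec (F : (T' -> R) -> nat -> R) :
    \prod_(m <= i < n) F (gc i) i = F (fun x => cos (th m x)) m * \prod_(m.+1 <= i < n) F (g i) i.
  rewrite big_ltn// /gc eqxx; congr (_ * _); apply: eq_big_nat => i /andP[mi _].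
  by rewrite gtn_eqF.
have Es (F : (T' -> R) -> nat -> R) :
    \prod_(m <= i < n) F (gs i) i = F (fun x => sin (th m x)) m * \prod_(m.+1 <= i < n) F (g i) i.
  rewrite big_ltn// /gs eqxx; congr (_ * _); apply: eq_big_nat => i /andP[mi _].
  by rewrite gtn_eqF.
have [c1 c2] := h _ bgc; have [s1 s2] := h _ bgs.
have bp (G : nat -> T' -> R) : (forall i, bmeas (G i)) ->
    bmeas (fun w => \prod_(m <= i < n) G i (D i w)).
  by move=> bG; apply: bmeas_prod => i; exact: bD.
have bc (G : nat -> T' -> R) : (forall i, bmeas (G i)) ->
    bmeas (fun w => cos (S m w) * \prod_(m <= i < n) G i (D i w)).
  by move=> bG; apply: bmeasM; [exact: bmeas_cos|exact: bp].
have bs (G : nat -> T' -> R) : (forall i, bmeas (G i)) ->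
    bmeas (fun w => sin (S m w) * \prod_(m <= i < n) G i (D i w)).
  by move=> bG; apply: bmeasM; [exact: bmeas_sin|exact: bp].
rewrite (Ec (fun f i => \int[P]_w f (D i w))) in c1 c2.
rewrite (Es (fun f i => \int[P]_w f (D i w))) in s1 s2.
split.
  transitivity (\int[P]_w (cos (S m w) * \prod_(m <= i < n) gc i (D i w)
      - sin (S m w) * \prod_(m <= i < n) gs i (D i w))).
    apply: eq_Rintegral => w _; rewrite (Ec (fun f i => f (D i w))).
    by rewrite (Es (fun f i => f (D i w))) /S big_ord_recr/= cosD; ring.
  by rewrite bintB; first [exact: bc|exact: bs|rewrite c1 s2 mulrA mulrA -mulrBl].
transitivity (\int[P]_w (sin (S m w) * \prod_(m <= i < n) gc i (D i w)
    + cos (S m w) * \prod_(m <= i < n) gs i (D i w))).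
  apply: eq_Rintegral => w _; rewrite (Ec (fun f i => f (D i w))).
  by rewrite (Es (fun f i => f (D i w))) /S big_ord_recr/= sinD; ring.
by rewrite bintD; first [exact: bc|exact: bs|rewrite c2 s1 mulrA mulrA -mulrDl].
Qed.

End charf.

(** * Inner product and sup norm on column vectors *)

Section dotp.
Context (R : realType) (d : nat).
Implicit Types u v w : 'cV[R]_d.

Lemma dotpDr u v w : dotp u (v + w) = dotp u v + dotp u w.
Proof. by rewrite -big_split; apply: eq_bigr => i _; rewrite mxE mulrDr. Qed.

Lemma dotpDl u v w : dotp (u + v) w = dotp u w + dotp v w.
Proof. by rewrite -big_split; apply: eq_bigr => i _; rewrite mxE mulrDl. Qed.

Lemma dotpZr c u v : dotp u (c *: v) = c * dotp u v.
Proof. by rewrite mulr_sumr; apply: eq_bigr => i _; rewrite mxE mulrCA. Qed.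

Lemma dotpZl c u v : dotp (c *: u) v = c * dotp u v.
Proof. by rewrite mulr_sumr; apply: eq_bigr => i _; rewrite mxE mulrA. Qed.

Lemma dotpNr u v : dotp u (- v) = - dotp u v.
Proof. by rewrite -scaleN1r dotpZr mulN1r. Qed.

Lemma dotpBr u v w : dotp u (v - w) = dotp u v - dotp u w.
Proof. by rewrite dotpDr dotpNr. Qed.

Lemma dotpBl u v w : dotp (u - v) w = dotp u w - dotp v w.
Proof. by rewrite -scaleN1r dotpDl dotpZl mulN1r. Qed.

Lemma dotp0r u : dotp u 0 = 0.
Proof. by rewrite -(scale0r 0) dotpZr mul0r. Qed.

Lemma dotp_sumr I (s : seq I) (p : pred I) u (F : I -> 'cV[R]_d) :
  dotp u (\sum_(i <- s | p i) F i) = \sum_(i <- s | p i) dotp u (F i).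
Proof.
by elim/big_rec2: _ => [|i x y _ <-]; rewrite ?dotp0r ?dotpDr.
Qed.

Lemma dotp_mulmx (M : 'M[R]_d) u v : dotp u (M *m v) = dotp (M^T *m u) v.
Proof.
rewrite /dotp; under eq_bigr do rewrite mxE mulr_sumr.
rewrite exchange_big/=; apply: eq_bigr => j _; rewrite mxE mulr_suml.
by apply: eq_bigr => i _; rewrite mxE mulrCA mulrA.
Qed.

Lemma measurable_dotp u : measurable_fun setT (dotp u).
Proof.
by apply: measurable_sum => i; apply: measurable_funM => //; exact: measurable_mx_coord.
Qed.

Lemma cV_norm_coord v i : `|v i 0| <= `|v|.
Proof.
rewrite {2}/Num.norm/= mx_normrE.
exact: (@le_bigmax _ _ _ 0 (fun ij : 'I_d * 'I_1 => `|v ij.1 ij.2|) (i, 0)).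
Qed.

Lemma cV_norm_le v e : 0 <= e -> (forall i, `|v i 0| <= e) -> `|v| <= e.
Proof.
move=> e0 h; rewrite {1}/Num.norm/= mx_normrE; apply: bigmax_le => // -[i j] _.
by rewrite ord1.
Qed.

Lemma cV_norm_max v : (0 < d)%N -> exists i, `|v| = `|v i 0|.
Proof.
move=> d0; have [->|v0] := eqVneq v 0.
  by exists (Ordinal d0); rewrite mxE !normr0.
have : mx_norm v != 0 by apply: contra v0 => /eqP/mx_norm_eq0 ->.
by move=> /mx_norm_neq0[[i j] /=]; rewrite (ord1 j) => h; exists i.
Qed.

(** Both norms on the right are sup norms, hence the factor [d]. *)
Lemma dotp_norm u v : `|dotp u v| <= d%:R * (`|u| * `|v|).
Proof.
rewrite (le_trans (ler_norm_sum _ _ _))//.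
rewrite -[X in _ <= X%:R * _]card_ord mulr_natl -sumr_const.
by apply: ler_sum => i _; rewrite normrM ler_pM// cV_norm_coord.
Qed.

End dotp.

(** * The generator on trigonometric functions *)

Section trigo_bounds.
Context (R : realType).

Lemma sin_le_id (x : R) : 0 <= x -> sin x <= x.
Proof.
move=> x0; have dE (y : R) : y \in `]0, x[ -> is_derive y 1 (fun x => x - sin x) (1 - cos y).
  by move=> _; apply: is_deriveB.
have cE : {within `[0, x], continuous (fun x : R => x - sin x)}.
  apply: continuous_subspaceT => y; apply: cvgB => //; exact: continuous_sin.
have [c _] := MVT_segment x0 dE cE.
rewrite sin0 !subr0 => h; rewrite -subr_ge0 h mulr_ge0// subr_ge0; exact: cos_le1.
Qed.

Lemma sin_norm_le (x : R) : `|sin x| <= `|x|.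
Proof.
wlog x0 : x / 0 <= x => [h|].
  have [/h//|/ltW x0] := leP 0 x.
  by rewrite -normrN -sinN -(normrN x); apply: h; rewrite oppr_ge0.
have [x1|x1] := leP 1 x.
  by rewrite (le_trans (sin_max _))// (le_trans x1)// ler_norm.
rewrite (ger0_norm x0) ger0_norm ?sin_le_id// sin_ge0_pi// x0/=.
by have := pihalf_ge1 R; lra.
Qed.

Lemma subr1_cos_le (x : R) : 1 - cos x <= x ^+ 2 / 2.
Proof.
have -> : cos x = cos ((x / 2) *+ 2) by rewrite -mulr_natr divfK.
rewrite cos_mulr2n cos2sin2.
have : sin (x / 2) ^+ 2 <= (x / 2) ^+ 2.
  by rewrite -[leLHS]real_normK ?num_real// -[leRHS]real_normK ?num_real// lerXn2r ?nnegrE// sin_norm_le.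
nra.
Qed.

Lemma cos_ge_half (x : R) : `|x| <= 1 -> 2^-1 <= cos x.
Proof.
move=> x1; have := subr1_cos_le x; rewrite -real_normK ?num_real//.
have : `|x| ^+ 2 <= 1 by rewrite expr_le1.
by lra.
Qed.

End trigo_bounds.

Section cos_wave.
Context (R : realType) (d : nat).
Implicit Types (xi x : 'cV[R]_d).

Lemma continuous_dotp xi : continuous (dotp xi).
Proof.
move=> x; apply/(@cvgrPdist_lt _ _ _ (nbhs x)) => e e0.
pose K := d%:R * `|xi| + 1; have K0 : 0 < K by rewrite ltr_wpDl// mulr_ge0.
near=> y; rewrite -dotpBr (le_lt_trans (dotp_norm _ _))// mulrA.
rewrite (@le_lt_trans _ _ (K * `|x - y|))//; first by rewrite ler_wpM2r// lerDl.
rewrite -ltr_pdivlMl// mulrC; near: y.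
exact: (@cvgr_dist_lt _ _ _ (nbhs x) _ id x (@cvg_id _ _)) (divr_gt0 e0 K0).
Unshelve. all: by end_near. Qed.

(** A partial derivative only rescales the amplitude and advances the phase by [pi / 2], so the
    family is closed under differentiation; the phase [- pi / 2] gives the sine. *)
Definition wave (c : R) xi (a : R) x := c * cos (dotp xi x + a).

Lemma is_derive_line (f : 'cV[R]_d -> R) x v df :
  is_derive (0 : R) 1 (fun h : R => f (h *: v + x)) df -> is_derive x v f df.
Proof.
move=> [dg gE].
have E : (fun h => h^-1 *: (((fun h => f (h *: v + x)) \o shift (0 : R)) (h *: 1) - f (0 *: v + x))) =
    (fun h => h^-1 *: ((f \o shift x) (h *: v) - f x)).
  by apply/funext => h; rewrite /= addr0 scale0r add0r /GRing.scale/= mulr1.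
by split; [rewrite /derivable -E|rewrite -gE /derive E].
Qed.

Lemma dotp_delta xi i : dotp xi (delta_mx i 0) = xi i 0.
Proof.
rewrite /dotp (bigD1 i)//= mxE !eqxx mulr1 big1 ?addr0// => j ji.
by rewrite mxE (negbTE ji) mulr0.
Qed.

Lemma is_derive_wave c xi a x i :
  is_derive x (delta_mx i 0) (wave c xi a) (wave (c * xi i 0) xi (a + pi / 2) x).
Proof.
apply: is_derive_line.
have -> : (fun h : R => wave c xi a (h *: delta_mx i 0 + x)) =
    c \*: (cos \o (fun h : R => xi i 0 * h + (dotp xi x + a))).
  by apply/funext => h; rewrite /wave/= dotpDr dotpZr dotp_delta addrA [h * _]mulrC.
have -> : wave (c * xi i 0) xi (a + pi / 2) x =
    c *: (- sin (xi i 0 * 0 + (dotp xi x + a)) * xi i 0).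
  rewrite /wave addrA cosDpihalf mulr0 add0r /GRing.scale/=; ring.
apply: is_deriveZ.
pose l (h : R) : R := xi i 0 * h + (dotp xi x + a).
have dl : is_derive (0 : R) 1 l (xi i 0).
  have -> : l = (xi i 0 \*: id) + cst (dotp xi x + a) by [].
  by apply: is_derive_eq; rewrite addr0 /GRing.scale/= mulr1.
exact: (is_derive1_comp (is_derive_cos (l 0)) dl).
Qed.

Lemma partial_wave c xi a i :
  partial i (wave c xi a) = wave (c * xi i 0) xi (a + pi / 2).
Proof. by apply/funext => x; rewrite /partial; have [_ ->] := is_derive_wave c xi a x i. Qed.

Lemma Cb_wave c xi a : Cb (wave c xi a).
Proof.
split.
  move=> x.
  have c1 : dotp xi y + a @[y --> nbhs x] --> dotp xi x + a.
    by apply: (@cvgD _ _ _ (nbhs x)); [exact: continuous_dotp|exact: (@cvg_cst _ _ _ (nbhs x))].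
  have c2 : cos (dotp xi y + a) @[y --> nbhs x] --> cos (dotp xi x + a).
    by have := continuous_cvg (nbhs_filter x) (@continuous_cos R (dotp xi x + a)) c1.
  exact: (@cvgM _ _ (nbhs x) _ (fun=> c) _ c _ (@cvg_cst _ c _ (nbhs x) _) c2).
exists `|c|; split; first exact: num_real.
move=> N cN x _ /=; rewrite /wave normrM (le_trans _ (ltW cN))// ler_piMr//.
exact: cos_max.
Qed.

Lemma Cb2_wave c xi a : Cb2 (wave c xi a).
Proof.
have pd c' a' : partial_derivable (wave c' xi a').
  by move=> x i; have [] := is_derive_wave c' xi a' x i.
split; first exact: Cb_wave.
  by split => // i; rewrite partial_wave; exact: Cb_wave.
move=> j; rewrite partial_wave; split; first exact: pd.
by move=> i; rewrite partial_wave; exact: Cb_wave.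
Qed.

Lemma gradient_wave0 xi : gradient (wave 1 xi 0) 0 = 0.
Proof.
apply/colP => i; rewrite !mxE partial_wave /wave dotp0r add0r add0r.
by rewrite cos_pihalf mulr0.
Qed.

Lemma hessian_wave0 xi : hessian (wave 1 xi 0) 0 = - (xi *m xi^T).
Proof.
apply/matrixP => i j; rewrite !mxE big_ord1 !partial_wave mxE /wave dotp0r !add0r.
by rewrite -splitr cospi mul1r mulrN1 mulrC.
Qed.

(** The real part of the symbol at [xi]. The cosine has zero gradient at the origin, which removes
    both the drift and the compensator of small jumps. *)
Lemma levy_operator_wave0 b Q nu xi :
  levy_operator b Q nu (wave 1 xi 0) 0 =
  - dotp xi (Q *m xi) + \int[nu]_z (cos (dotp xi z) - 1).
Proof.
rewrite /levy_operator gradient_wave0 hessian_wave0 dotp0r add0r; congr (_ + _).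
  rewrite mulmxN raddfN/= mulmxA mxtrace_mulC /mxtrace big_ord1; congr (- _).
  by rewrite mxE; apply: eq_bigr => i _; rewrite !mxE.
apply: eq_Rintegral => z _.
have d0z : dotp 0 z = 0 by rewrite /dotp big1// => i _; rewrite mxE mul0r.
by rewrite /wave d0z mul0r subr0 !addr0 dotp0r cos0 !mul1r.
Qed.

End cos_wave.

(** * Boxes and the symbol *)

Section box.
Context (R : realType).

(** Half-open, so that the cells of a grid are exactly boxes and tile the space. *)
Definition box d (a : 'cV[R]_d) (s : R) : set 'cV[R]_d :=
  [set v | forall i, a i 0 <= v i 0 < a i 0 + s].

Lemma measurable_box d (a : 'cV[R]_d) s : measurable (box a s).
Proof.
have -> : box a s = \bigcap_(i in [set: 'I_d])
    ((fun v : 'cV[R]_d => v i 0) @^-1` `[a i 0, a i 0 + s[%classic).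
  apply/seteqP; split => [v h i _|v h i] /=; first by rewrite in_itv/= h.
  by have := h i I; rewrite /= in_itv.
apply: fin_bigcap_measurable => // i _.
by rewrite -[X in measurable X]setTI; exact: measurable_mx_coord.
Qed.

Lemma lebesgue_measure_box d (a : 'cV[R]_d) s : 0 <= s ->
  lebesgue_measure_cV (box a s) = (s ^+ d)%:E.
Proof.
move=> s0; elim: d a => [a|d ih a].
  rewrite expr0 [LHS]/= diracE mem_set// => -[]//.
have -> : @lebesgue_measure_cV R d.+1 (box a s) =
    (lebesgue_measure \x @lebesgue_measure_cV R d)%E
      (`[a ord0 0, a ord0 0 + s[%classic `*` box (unconsc a).2 s).
  rewrite [LHS]/= /pushforward; congr (product_measure1 _ _ _).
  apply/seteqP; split => -[x v]; rewrite /box/= in_itv/=.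
    move=> h; split; first by have := h ord0; rewrite mxE unlift_none.
    by move=> i; have := h (lift ord0 i); rewrite !mxE liftK.
  move=> [hx hv] i; rewrite /consc mxE; case: unliftP => [k ->|->]//.
  by have := hv k; rewrite mxE.
rewrite product_measure1E//; last exact: measurable_box.
rewrite [X in (_ * X)%E](ih (unconsc a).2) [X in (X * _)%E](lebesgue_measure_itv `[a ord0 0, a ord0 0 + s[)/= lte_fin ltrDl exprS EFinM.
case: ltP => [_|s0']; first by rewrite -EFinB addrAC subrr add0r.
by have -> : s = 0 by apply/eqP; rewrite eq_le s0 s0'.
Qed.

End box.

Section enorm.
Context (R : realType) (d : nat).
Implicit Types z : 'cV[R]_d.

Lemma enorm_ge0 z : 0 <= enorm z.
Proof. exact: sqrtr_ge0. Qed.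

Lemma cV_norm_le_enorm z : `|z| <= enorm z.
Proof.
apply: cV_norm_le => [|i]; first exact: enorm_ge0.
rewrite -sqrtr_sqr ler_wsqrtr// /dotp (bigD1 i)//= expr2 lerDl.
by apply: sumr_ge0 => j _; rewrite -expr2 sqr_ge0.
Qed.

Lemma enorm_le_cV_norm z : enorm z <= d%:R * `|z|.
Proof.
rewrite -[leRHS]ger0_norm ?mulr_ge0// -sqrtr_sqr ler_wsqrtr//.
rewrite (le_trans (ler_norm _))// (le_trans (dotp_norm _ _))// exprMn -expr2.
by rewrite ler_wpM2r ?sqr_ge0// -natrX ler_nat -mulnn; case: (d) => // n; exact: leq_pmulr.
Qed.

Lemma measurable_enorm : measurable_fun setT (@enorm R d).
Proof.
apply: (@measurableT_comp _ _ _ _ _ _ (@Num.sqrt R)).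
  by apply: continuous_measurable_fun; exact: sqrt_continuous.
by apply: measurable_sum => i; apply: measurable_funM; exact: measurable_mx_coord.
Qed.

End enorm.

Lemma box_norm (R : realType) d (a z : 'cV[R]_d) s :
  0 <= s -> box a s z -> `|z - a| <= s.
Proof.
move=> s0 Bz; apply: cV_norm_le => // i.
have /andP[h1 h2] := Bz i; rewrite mxE [X in _ + X]mxE ler_norml.
by apply/andP; split; lra.
Qed.

Section symbol.
Context (R : realType) (d : nat) (nu : {measure set 'cV[R]_d -> \bar R}).
Hypothesis hnu : levy_measure nu.

(** The quadratic bound serves small [z], the bound by 2 large [z]; together they compare with the
    integrand of [levy_measure]. *)
Lemma subr1_cos_dotp_le (xi z : 'cV[R]_d) :
  1 - cos (dotp xi z) <= (2 + (d%:R * `|xi|) ^+ 2) * Num.min (enorm z ^+ 2) 1.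
Proof.
set K := d%:R * `|xi|.
have K0 : 0 <= K by exact: mulr_ge0.
have := cos_geN1 (dotp xi z); have := subr1_cos_le (dotp xi z).
have : dotp xi z ^+ 2 <= (K * enorm z) ^+ 2.
  rewrite -[leLHS]real_normK ?num_real// lerXn2r ?nnegrE//.
    by rewrite mulr_ge0// enorm_ge0.
  by rewrite (le_trans (dotp_norm _ _))// mulrA ler_wpM2l// cV_norm_le_enorm.
rewrite exprMn; have := mulr_ge0 (sqr_ge0 K) (sqr_ge0 (enorm z)).
have := sqr_ge0 K; have := sqr_ge0 (enorm z).
move: (enorm z ^+ 2) (K ^+ 2) (dotp _ _ ^+ 2) => e k p e0 k0 ke pke pc cn.
by rewrite /Num.min; case: ltP => _; lra.
Qed.

Lemma measurable_cos_dotp (xi : 'cV[R]_d) :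
  measurable_fun setT (fun z => cos (dotp xi z)).
Proof. by have [] := bmeas_cos (measurable_dotp xi). Qed.

Lemma integrable_1_cos (xi : 'cV[R]_d) :
  nu.-integrable setT (fun z => (1 - cos (dotp xi z))%:E).
Proof.
pose K := 2 + (d%:R * `|xi|) ^+ 2.
have K0 : 0 <= K by rewrite addr_ge0// sqr_ge0.
have ge0 (z : 'cV[R]_d) : 0 <= Num.min (enorm z ^+ 2) 1.
  by rewrite le_min sqr_ge0/=.
apply: (@le_integrable _ _ _ _ _ _ _ (fun z => K%:E * (Num.min (enorm z ^+ 2) 1)%:E)%E) => //.
- apply/measurable_EFinP; apply: measurable_funB => //; exact: measurable_cos_dotp.
- move=> z _; rewrite lee_fin ger0_norm ?subr_ge0 ?cos_le1// (le_trans (subr1_cos_dotp_le _ _))//.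
  exact: ler_norm.
- apply: integrableZl => //; apply/integrableP; split.
    apply/measurable_EFinP; apply: measurable_minr => //.
    by apply: measurable_funX; exact: measurable_enorm.
  under eq_integral do rewrite gee0_abs ?lee_fin//.
  by case: hnu.
Qed.

Lemma Rintegral_cos_1 (xi : 'cV[R]_d) :
  \int[nu]_z (cos (dotp xi z) - 1) = - \int[nu]_z (1 - cos (dotp xi z)).
Proof.
transitivity (\int[nu]_z (-1 * (1 - cos (dotp xi z)))).
  by apply: eq_Rintegral => z _; rewrite mulN1r opprB.
by rewrite RintegralZl// ?mulN1r//; exact: integrable_1_cos.
Qed.

Context (alpha c r : R).
Hypotheses (alpha0 : 0 < alpha) (c0 : 0 < c) (r0 : 0 < r) (d0 : (0 < d)%N).
Hypothesis hlower : forall B : set 'cV[R]_d, measurable B ->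
    (\int[@lebesgue_measure_cV R d]_(z in B)
       (c / enorm z `^ (alpha + d%:R) * (enorm z < r)%R%:R)%:E <= nu B)%E.

(* The box has side comparable to 1 / |xi| and [dotp xi] takes values in
   [1/2, 3/2] on it. *)
Lemma symbol_box : exists2 c1 : R, 0 < c1 & exists2 rho : R, 0 < rho &
  forall xi : 'cV[R]_d, rho <= `|xi| -> exists B : set 'cV[R]_d,
    [/\ measurable B, forall z, B z -> 2^-1 <= dotp xi z <= 3 / 2 &
        ((c1 * `|xi| `^ alpha)%:E <= nu B)%E].
Proof.
pose D : R := d%:R; have D0 : 0 < D by rewrite ltr0n.
have D1 : 1 <= D by rewrite ler1n.
pose p := alpha + D.
(* The first factor is the density at distance [2 D / |xi|], the second the volume of a box of side
   [1 / (2 D |xi|)], both without their powers of [|xi|]. *)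
exists (c / (2 * D) `^ p * ((2 * D) ^+ d)^-1).
  by rewrite !mulr_gt0 ?invr_gt0 ?powR_gt0 ?exprn_gt0 ?mulr_gt0.
(* For [|xi|] above this threshold the box lies within Euclidean distance [r / 2] of the origin,
   where the lower bound on [nu] is available. *)
exists (4 * D / r); first by rewrite divr_gt0 ?mulr_gt0.
move=> xi hxi; pose M := `|xi|.
have M0 : 0 < M by apply: lt_le_trans hxi; rewrite divr_gt0 ?mulr_gt0.
have [j Mj] := cV_norm_max xi d0.
(* A point on the axis of the largest coordinate of [xi] with [dotp xi a = 1]; the side [s] is
   chosen so that [dotp xi] varies by at most 1/2 over the box. *)
pose a : 'cV[R]_d := (Num.sg (xi j 0) / M) *: delta_mx j 0.
pose s := (2 * D * M)^-1; have s0 : 0 < s by rewrite invr_gt0 !mulr_gt0.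
have DMs : D * M * s = 2^-1 by rewrite /s; field; rewrite !gt_eqF.
have xiz z : box a s z -> 2^-1 <= dotp xi z <= 3 / 2.
  move=> Bz.
  have xia : dotp xi a = 1.
    rewrite dotpZr dotp_delta mulrAC -normrEsg -Mj -/M divff//; exact: lt0r_neq0.
  have -> : dotp xi z = 1 + dotp xi (z - a) by rewrite dotpBr xia addrC subrK.
  have zas := box_norm (ltW s0) Bz.
  have := dotp_norm xi (z - a); rewrite -/M -/D => h.
  have : `|dotp xi (z - a)| <= 2^-1.
    by rewrite -DMs (le_trans h)// mulrA ler_wpM2l// mulr_ge0// ltW.
  by rewrite ler_norml => /andP[? ?]; apply/andP; split; lra.
exists (box a s); split => //; first exact: measurable_box.
have aM : `|a| <= M^-1.
    rewrite normrZ -[leRHS]mulr1 ler_pM//.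
      by rewrite normrM normr_sg normfV (gtr0_norm M0) ler_piMl ?invr_ge0 ?lern1 ?leq_b1 ?(ltW M0).
    by apply: cV_norm_le => // i; rewrite mxE; case: (_ && _); rewrite ?normr1 ?normr0.
  have sM : s <= M^-1.
    by rewrite lef_pV2 ?posrE ?mulr_gt0// ler_peMl ?ltW//; lra.
  have zle z : box a s z -> enorm z <= 2 * D / M.
    move=> Bz; rewrite (le_trans (enorm_le_cV_norm z))// -/D.
    have -> : z = a + (z - a) by rewrite addrC subrK.
    have zas := box_norm (ltW s0) Bz.
    have := ler_normD a (z - a); nra.
  have zgt z : box a s z -> 0 < enorm z.
    move=> Bz; rewrite lt_neqAle enorm_ge0 andbT eq_sym; apply/eqP => e0.
    have : `|z| <= 0 by rewrite -e0 cV_norm_le_enorm.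
    rewrite normr_le0 => /eqP z0.
    by have := xiz _ Bz; rewrite z0 dotp0r => /andP[]; lra.
  (* Density of order [M^(alpha + d)] times volume of order [M^(- d)]. *)
  have pE : M `^ p * M ^- d = M `^ alpha.
    rewrite /p powRD ?(gt_eqF M0) ?implybT// powR_mulrn ?ltW// mulfK//.
    by rewrite expf_neq0// gt_eqF.
  apply: le_trans (hlower (measurable_box a s)).
  rewrite (eq_integral (fun z => (c * enorm z `^ (- p))%:E)); last first.
    move=> z /set_mem Bz; rewrite -powRN; congr (_%:E).
    rewrite (_ : enorm z < r) ?mulr1//; apply: le_lt_trans (zle z Bz) _.
    by move: hxi; rewrite -/M ler_pdivrMr// ltr_pdivrMr//; nra.
  apply: (@le_trans _ _ (\int[@lebesgue_measure_cV R d]_(z in box a s) (cst (c * (2 * D / M) `^ (- p))%:E z))%E).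
    rewrite integral_cst; last exact: measurable_box.
    rewrite [X in (_ * X)%E](lebesgue_measure_box a (ltW s0)) -EFinM lee_fin -pE.
    have qE : (2 * D) `^ p = (2 * D / M) `^ p * M `^ p.
      rewrite -powRM ?divfK ?gt_eqF// ?divr_ge0 ?mulr_ge0// ltW//.
    rewrite qE powRN /s exprVn (_ : (2 * D * M) ^+ d = (2 * D) ^+ d * M ^+ d); last by rewrite exprMn.
    rewrite le_eqVlt; apply/orP; left; apply/eqP.
    have q0 : (2 * D / M) `^ p != 0 by rewrite gt_eqF// powR_gt0// divr_gt0 ?mulr_gt0.
    have p0 : M `^ p != 0 by rewrite gt_eqF// powR_gt0.
    have t0 : (2 * D) ^+ d != 0 by rewrite expf_neq0// gt_eqF// mulr_gt0.
    have m0 : M ^+ d != 0 by rewrite expf_neq0// gt_eqF.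
    move: q0 p0 t0 m0; generalize ((2 * D / M) `^ p) (M `^ p) ((2 * D) ^+ d) (M ^+ d) => q1 p1 t1 m1 q0 p0 t0 m0.
    by field; rewrite q0 p0 t0 m0.
  apply: ge0_le_integral.
  + exact: measurable_box.
  + by move=> z _; rewrite lee_fin mulr_ge0 ?powR_ge0// ltW.
  + exact: measurable_cst.
  + apply/measurable_EFinP; apply: measurable_funM => //; apply: measurable_funTS.
    apply: (@measurableT_comp _ _ _ _ _ _ (fun x : R => x `^ (- p))).
      exact: measurable_powR.
    exact: measurable_enorm.
  + move=> z Bz; rewrite lee_fin; apply: ler_wpM2l; first exact: ltW.
    have DM0 : 0 < 2 * D / M by rewrite divr_gt0 ?mulr_gt0.
    rewrite !powRN lef_pV2 ?posrE ?powR_gt0 ?zgt//.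
    apply: ge0_ler_powR; rewrite ?nnegrE ?enorm_ge0 ?zle ?(ltW DM0)//.
    by rewrite addr_ge0 ?(ltW alpha0) ?(ltW D0).
Qed.

(** The integrand [1 - cos] is nonnegative, so the integral may be restricted to the box of
    [symbol_box]. There the angle lies in [[1/2, 3/2]], inside [[0, pi]], and [1 - cos] is at least
    [1 - cos (1/2)]. *)
Lemma symbol_le : exists2 c1 : R, 0 < c1 & exists2 rho : R, 0 < rho &
  forall xi : 'cV[R]_d, rho <= `|xi| ->
  \int[nu]_z (cos (dotp xi z) - 1) <= - (c1 * `|xi| `^ alpha).
Proof.
have [c1 c10 [rho rho0 h]] := symbol_box.
have hpi : (3 / 2 : R) <= pi by have := pi_ge2 R; lra.
have itv (x : R) : 0 <= x -> x <= 3 / 2 -> x \in `[0, pi].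
  by move=> x0 x1; rewrite in_itv/= x0 (le_trans x1).
have i0 : (0 : R) \in `[0, pi] by rewrite itv//; lra.
have i2 : (2^-1 : R) \in `[0, pi] by rewrite itv//; lra.
pose k : R := 1 - cos 2^-1; have k0 : 0 < k.
  have : cos (2^-1 : R) < cos 0 by rewrite ltr_cos// invr_gt0.
  by rewrite cos0 subr_gt0.
exists (k * c1); first exact: mulr_gt0.
exists rho => // xi hxi; have [B [mB Bxi nuB]] := h _ hxi.
rewrite Rintegral_cos_1 lerN2 -mulrA.
have mf : measurable_fun setT (fun z => (1 - cos (dotp xi z))%:E).
  by have /integrableP[] := integrable_1_cos xi.
rewrite -lee_fin /Rintegral fineK; last exact/integrable_fin_num/integrable_1_cos.
apply: (@le_trans _ _ (\int[nu]_(z in B) (1 - cos (dotp xi z))%:E)%E); last first.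
  apply: ge0_subset_integral => // z _; rewrite lee_fin subr_ge0; exact: cos_le1.
apply: (@le_trans _ _ (\int[nu]_(z in B) cst k%:E z)%E).
  by rewrite integral_cst// EFinM; apply: lee_wpmul2l => //; rewrite lee_fin ltW.
apply: ge0_le_integral => //.
- by move=> z _; rewrite lee_fin ltW.
- exact: measurable_funTS.
- move=> z /Bxi /andP[z1 z2]; rewrite lee_fin lerD2l lerN2.
  have [<-//|zE] := eqVneq 2^-1 (dotp xi z).
  by apply/ltW; rewrite ltr_cos ?itv//; first [by rewrite lt_neqAle zE|lra].
Qed.

End symbol.

(** * Decay of the characteristic function of the driving process *)

Section levy.
Context (R : realType) (d : nat) (d0 : measure_display).
Context (Omega : measurableType d0) (P : probability Omega R).
Context (L : R -> Omega -> 'cV[R]_d).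
Hypothesis hL : levy_process P L.

Lemma measurable_cV_sub (T : measurableType d0) (X Y : T -> 'cV[R]_d) :
  measurable_fun setT X -> measurable_fun setT Y ->
  measurable_fun setT (fun w => X w - Y w).
Proof.
move=> mX mY; apply: measurable_fun_mxP => i j.
have E (A B : 'cV[R]_d) : (A - B) i j = A i j - B i j by rewrite mxE [X in _ + X]mxE.
under eq_fun do rewrite E.
by apply: measurable_funB;
  apply: (@measurableT_comp _ _ _ _ _ _ (fun v : 'cV[R]_d => v i j)) => //; exact: measurable_mx_coord.
Qed.

Lemma measurable_levy_incr s t : 0 <= s -> 0 <= t ->
  measurable_fun setT (fun w => L t w - L s w).
Proof. by move=> s0 t0; apply: measurable_cV_sub; exact: levy_measurable hL _ _. Qed.

Lemma levy_incr_law s h (g : 'cV[R]_d -> R) : 0 <= s -> 0 <= h -> bmeas g ->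
  \int[P]_w g (L (s + h) w - L s w) = \int[P]_w g (L h w).
Proof.
move=> s0 h0 bg.
have mh := levy_measurable hL h0.
(* Stationarity compares with [L h - L 0], and [L 0 = 0] holds only almost surely. *)
transitivity (\int[P]_w g (L h w - L 0 w)); last first.
  congr fine; apply: ae_eq_integral => //.
  - apply/measurable_EFinP; have [] := bmeas_comp (measurable_levy_incr (lexx 0) h0) bg.
    by [].
  - by apply/measurable_EFinP; have [] := bmeas_comp mh bg.
  - have := levy_start hL => -[N [mN N0 sN]]; exists N; split => // w /= hw.
    by apply: sN => /= Lw; apply: hw => _; rewrite Lw subr0.
apply/eqP; rewrite -subr_eq0; apply/eqP.
have sh0 : 0 <= s + h by exact: addr_ge0.
have m1 := measurable_levy_incr s0 sh0; have m2 := measurable_levy_incr (lexx 0) h0.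
have b1 f : bmeas f -> bmeas (fun w => f (L (s + h) w - L s w)) by exact: bmeas_comp.
have b2 f : bmeas f -> bmeas (fun w => f (L h w - L 0 w)) by exact: bmeas_comp.
pose Phi (f : 'cV[R]_d -> R) := \int[P]_w f (L (s + h) w - L s w) - \int[P]_w f (L h w - L 0 w).
apply: (@bmeas_ind _ _ _ Phi 2) => //.
- by move=> f f' bf bf'; rewrite /Phi !bintD//; first [exact: b1|exact: b2|ring].
- by move=> c f bf; rewrite /Phi !bintZ//; first [exact: b1|exact: b2|ring].
- move=> f e bf fe; rewrite /Phi (le_trans (ler_normB _ _))// mulr_natl mulr2n lerD//.
    by apply: bint_norm => //; exact: b1.
  by apply: bint_norm => //; exact: b2.
- move=> B mB; rewrite /Phi.
  transitivity (fine (P [set w | B (L (s + h) w - L s w)]) - fine (P [set w | B (L h w - L 0 w)])).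
    congr (_ - _); rewrite -bint_indic//.
      by rewrite -[X in measurable X]setTI; exact: m1.
    by rewrite -[X in measurable X]setTI; exact: m2.
  by rewrite (levy_stationary hL)// subrr.
Qed.

Lemma cf2_levy_incr s h xi : 0 <= s -> 0 <= h ->
  cf2 P (fun w => dotp xi (L (s + h) w - L s w)) = cf2 P (fun w => dotp xi (L h w)).
Proof.
move=> s0 h0; rewrite /cf2.
rewrite (levy_incr_law s0 h0 (bmeas_cos (measurable_dotp xi))).
by rewrite (levy_incr_law s0 h0 (bmeas_sin (measurable_dotp xi))).
Qed.

Lemma cf2_levy_sum n h (eta : nat -> 'cV[R]_d) : 0 <= h ->
  cf2 P (fun w => \sum_(i < n) dotp (eta i) (L (i.+1%:R * h) w - L (i%:R * h) w)) =
  \prod_(i < n) cf2 P (fun w => dotp (eta i) (L h w)).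
Proof.
move=> h0; have ih0 i : 0 <= i%:R * h by exact: mulr_ge0.
rewrite (@cf2_indep _ _ _ P _ _ n (fun i w => L (i.+1%:R * h) w - L (i%:R * h) w)
  (fun i => dotp (eta i))).
- apply: eq_bigr => i _; rewrite -(cf2_levy_incr (eta i) (ih0 i) h0).
  by apply: eq_cf2 => w; rewrite -natr1 mulrDl mul1r.
- by move=> i; exact: measurable_levy_incr.
- by move=> i; exact: measurable_dotp.
- move=> B mB; have iL : independent_increments P L := levy_independent hL.
  have := @iL n (fun i => i%:R * h) (ih0 0%N) _ B mB; apply.
  by move=> i; rewrite ler_wpM2r// ler_nat.
Qed.

Lemma cf2_levyX n h xi : 0 <= h ->
  cf2 P (fun w => dotp xi (L (n%:R * h) w)) = cf2 P (fun w => dotp xi (L h w)) ^+ n.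
Proof.
move=> h0; have nh0 : 0 <= n%:R * h by exact: mulr_ge0.
rewrite -(cf2_levy_incr _ (lexx 0) nh0) add0r.
rewrite -[X in _ ^+ X]card_ord -prodr_const -(cf2_levy_sum n (fun=> xi) h0).
apply: eq_cf2 => w; rewrite -dotp_sumr; congr dotp.
by rewrite -(big_mkord xpredT (fun i => L (i.+1%:R * h) w - L (i%:R * h) w)) telescope_sumr// mul0r.
Qed.

End levy.

Section levy_decay.
Context (R : realType) (d : nat) (d0 : measure_display).
Context (Omega : measurableType d0) (P : probability Omega R).
Context (b : 'cV[R]_d) (Q : 'M[R]_d) (nu : {measure set 'cV[R]_d -> \bar R}).
Context (L : R -> Omega -> 'cV[R]_d).
Hypothesis hL : levy_process P L.
Hypothesis hgen : generated_by P L (levy_operator b Q nu).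

(** With [C] and [S] the integrals of the cosine and sine, the generator gives [C = 1 + G t + o(t)]
    with [G <= - K], and [S = O(t)]. Hence [C^2 + S^2 <= 1 - K t <= exp(- K t)] for small [t]. *)
Lemma cf2_levy_small xi K : 0 < K ->
  levy_operator b Q nu (wave 1 xi 0) 0 <= - K ->
  exists2 e : R, 0 < e &
    forall t, 0 < t -> t < e -> cf2 P (fun w => dotp xi (L t w)) <= expR (- K * t).
Proof.
move=> K0 GK; pose C t := \int[P]_w cos (dotp xi (L t w)).
pose S t := \int[P]_w sin (dotp xi (L t w)).
set G := levy_operator _ _ _ _ _ in GK.
have cC : (C t - 1) / t @[t --> 0^'+] --> G.
  have := @hgen _ (Cb2_wave 1 xi 0) 0.
  rewrite [X in X @ _ --> _ -> _](_ : _ = (fun t => (C t - 1) / t))//.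
  apply/funext => t; rewrite {2}/wave dotp0r addr0 cos0 mulr1; congr ((_ - _) / _).
  by rewrite /C; apply: eq_Rintegral => w _; rewrite /wave add0r addr0 mul1r.
(* The sine is the wave of phase [- pi / 2], which vanishes at the origin. *)
have [Gs cS] : exists Gs : R, S t / t @[t --> 0^'+] --> Gs.
  exists (levy_operator b Q nu (wave 1 xi (- (pi / 2))) 0).
  have := @hgen _ (Cb2_wave 1 xi (- (pi / 2))) 0.
  rewrite [X in X @ _ --> _ -> _](_ : _ = (fun t => S t / t))//.
  apply/funext => t; rewrite {2}/wave dotp0r add0r cosN cos_pihalf mulr0 subr0.
  congr (_ / _); rewrite /S; apply: eq_Rintegral => w _; rewrite /wave add0r mul1r.
  by rewrite -sinDpihalf subrK.
pose B := `|Gs| + 1; pose D := `|G| + 1.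
have B0 : 0 < B by rewrite ltr_wpDl.
have D0 : 0 < D by rewrite ltr_wpDl.
(* The coefficient of [t^2] in [(1 - 3/4 K t)^2 + (B t)^2]. The slope [3/4 K] instead of [K] leaves
   a margin [K t / 2] that absorbs [M t^2]. *)
pose M := 9 / 16 * K ^+ 2 + B ^+ 2.
have M0 : 0 < M.
  by apply: ltr_wpDl; rewrite ?exprn_gt0// mulr_ge0 ?sqr_ge0//; lra.
have : \forall t \near 0^'+, cf2 P (fun w => dotp xi (L t w)) <= expR (- K * t).
  near=> t.
  have t0 : 0 < t by [].
  have h1 : (C t - 1) / t < - (3 / 4 * K).
    by near: t; apply: (cvgr_lt _ cC); lra.
  have h2 : - D < (C t - 1) / t.
    by near: t; apply: (cvgr_gt _ cC); have := ler_norm (- G); rewrite normrN /D; lra.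
  have h3 : `|S t / t| < B by near: t; apply: (cvgr_norm_lt _ cS); rewrite ltrDl.
  (* Together with [h2] this makes [C t] positive, so that its upper bound may be squared. *)
  have h4 : t < D^-1 by near: t; apply: nbhs_right_lt; rewrite invr_gt0.
  have h5 : t < K / 2 / M by near: t; apply: nbhs_right_lt; rewrite !divr_gt0.
  move: h1; rewrite ltr_pdivrMr// => h1.
  move: h2; rewrite ltr_pdivlMr// => h2.
  move: h3; rewrite normrM normfV (gtr0_norm t0) ltr_pdivrMr// => h3.
  move: h4; rewrite -[_^-1]mul1r ltr_pdivlMr// => h4.
  move: h5; rewrite ltr_pdivlMr// => h5.
  apply: (@le_trans _ _ (1 - K * t)); last by rewrite -mulNr expR_ge1Dx.
  rewrite /cf2 -/(C t) -/(S t).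
  have hS : S t ^+ 2 <= (B * t) ^+ 2.
    rewrite -[leLHS]real_normK ?num_real//.
    by rewrite lerXn2r ?nnegrE ?normr_ge0 ?mulr_ge0 ?(ltW B0) ?(ltW t0) ?(ltW h3).
  have hC : C t ^+ 2 <= (1 - 3 / 4 * K * t) ^+ 2.
    by rewrite lerXn2r ?nnegrE; lra.
  have : t * M * t <= K / 2 * t by rewrite ler_wpM2r ?ltW.
  rewrite /M; nra.
move=> /nbhs_ballP[e /= e0 H]; exists e => // t t0 te; apply: H => //=.
by rewrite /ball/= sub0r normrN gtr0_norm.
Unshelve. all: by end_near. Qed.

(** Cut [[0, t]] into [n] pieces shorter than the [e] of [cf2_levy_small] and multiply by
    [cf2_levyX]. *)
Lemma cf2_levy_le xi K t : 0 < K ->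
  levy_operator b Q nu (wave 1 xi 0) 0 <= - K -> 0 <= t ->
  cf2 P (fun w => dotp xi (L t w)) <= expR (- K * t).
Proof.
move=> K0 GK; rewrite le_eqVlt => /predU1P[<-|t0].
  rewrite mulr0 expR0; apply: cf2_le1; apply: measurableT_comp; first exact: measurable_dotp.
  exact: levy_measurable hL _ _.
have [e e0 H] := cf2_levy_small K0 GK.
pose n := (Num.bound (t / e)).+1.
have n0 : 0 < n%:R :> R by rewrite ltr0n.
have tn : t / n%:R < e.
  rewrite ltr_pdivrMr// mulrC -ltr_pdivrMr// (lt_trans (archi_boundP _))// ?divr_ge0 ?ltW//.
  by rewrite ltr_nat.
have tn0 : 0 < t / n%:R by rewrite divr_gt0.
have tE : t = n%:R * (t / n%:R) by rewrite mulrC divfK// gt_eqF.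
rewrite tE cf2_levyX ?(ltW tn0)// mulrCA expRM_natl.
by rewrite lerXn2r ?nnegrE ?expR_ge0 ?cf2_ge0// H.
Qed.

Context (alpha c r : R).
Hypotheses (hQ : nonneg_definite Q) (hnu : levy_measure nu).
Hypotheses (alpha0 : 0 < alpha) (c0 : 0 < c) (r0 : 0 < r) (dpos : (0 < d)%N).
Hypothesis hlower : forall B : set 'cV[R]_d, measurable B ->
    (\int[@lebesgue_measure_cV R d]_(z in B)
       (c / enorm z `^ (alpha + d%:R) * (enorm z < r)%R%:R)%:E <= nu B)%E.

Lemma cf2_levy_decay : exists2 c1 : R, 0 < c1 & exists2 c2 : R, 0 <= c2 &
  forall xi t, 0 <= t ->
  cf2 P (fun w => dotp xi (L t w)) <= expR (t * (c2 - c1 * `|xi| `^ alpha)).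
Proof.
have [c1 c10 [rho rho0 h]] := symbol_le hnu alpha0 c0 r0 dpos hlower.
(* This [c2] makes the exponent nonnegative for [|xi| < rho], where only the trivial bound 1 is
   used. *)
exists c1 => //; exists (c1 * rho `^ alpha); first by rewrite mulr_ge0 ?powR_ge0// ltW.
move=> xi t t0; have [rxi|xir] := leP rho `|xi|.
  have xi0 : 0 < `|xi| by exact: lt_le_trans rxi.
  apply: (@le_trans _ _ (expR (- (c1 * `|xi| `^ alpha) * t))).
    apply: cf2_levy_le => //; first by rewrite mulr_gt0 ?powR_gt0.
    rewrite levy_operator_wave0; have := h _ rxi; have [_ /(_ xi)] := hQ; lra.
  rewrite ler_expR mulNr mulrBr [t * (_ * `|xi| `^ _)]mulrC lerDr mulr_ge0//.
  by rewrite mulr_ge0 ?powR_ge0// ltW.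
apply: (@le_trans _ _ 1).
  apply: cf2_le1; apply: measurableT_comp; first exact: measurable_dotp.
  exact: levy_measurable hL _ _.
rewrite -expR0 ler_expR; apply: mulr_ge0 => //; rewrite -mulrBr.
apply: mulr_ge0; first exact: ltW.
by rewrite subr_ge0 ge0_ler_powR ?nnegrE ?(ltW alpha0) ?(ltW rho0) ?(ltW xir).
Qed.

End levy_decay.

(** * Right Riemann sums *)

Section right_riemann.
Context (R : realType).
Notation mu := (@lebesgue_measure R).

Definition cell (h : R) (k : nat) : set R := `]k%:R * h, k.+1%:R * h]%classic.

Lemma measurable_cell h k : measurable (cell h k).
Proof. exact: measurable_itv. Qed.

Lemma mu_cell h k : 0 < h -> mu (cell h k) = h%:E.
Proof.
move=> h0; rewrite [LHS]lebesgue_measure_itv/= lte_fin ltr_pM2r// ltr_nat ltnSn.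
by rewrite -EFinB -natr1 mulrDl mul1r addrAC subrr add0r.
Qed.

Lemma in_cell h k s : cell h k s = (k%:R * h < s <= k.+1%:R * h) :> Prop.
Proof. by rewrite /cell/= in_itv. Qed.

Lemma cell_ex h s m : 0 < s -> s <= m%:R * h ->
  exists2 k, (k < m)%N & cell h k s.
Proof.
elim: m => [|m ih] s0 sm; first by move: sm; rewrite mul0r leNgt s0.
have [sm'|ms] := leP s (m%:R * h); last by exists m => //; rewrite in_cell ms.
by have [k km ks] := ih s0 sm'; exists k => //; exact: ltnW.
Qed.

Lemma cell_uniq h s i k : 0 < h -> cell h i s -> cell h k s -> i = k.
Proof.
move=> h0; rewrite !in_cell => /andP[i1 i2] /andP[k1 k2].
have ik : (i < k.+1)%N by rewrite -(ltr_nat R) -(ltr_pM2r h0); exact: lt_le_trans k2.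
have ki : (k < i.+1)%N by rewrite -(ltr_nat R) -(ltr_pM2r h0); exact: lt_le_trans i2.
by apply/eqP; rewrite eqn_leq -ltnS ik -ltnS ki.
Qed.

(** Sampling at right endpoints, as in the implicit Euler scheme: the sample points approach [s]
    from the right, where cadlag paths are continuous. *)
Definition right_step (g : R -> R) (h : R) (n : nat) (s : R) : R :=
  \sum_(k < n) g (k.+1%:R * h) * \1_(cell h k) s.

Lemma right_stepE g h n k s : 0 < h -> (k < n)%N -> cell h k s ->
  right_step g h n s = g (k.+1%:R * h).
Proof.
move=> h0 kn ks; rewrite /right_step (bigD1 (Ordinal kn))//= indicE mem_set// mulr1.
rewrite big1 ?addr0// => i; rewrite -val_eqE/= => ik.
rewrite indicE memNset ?mulr0// => is_; move/eqP: ik; apply.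
exact: cell_uniq is_ ks.
Qed.

Lemma measurable_right_step g h n D : measurable_fun D (right_step g h n).
Proof.
apply: measurable_funTS; apply: measurable_sum => k; apply: measurable_funM => //.
by apply: measurable_indic; exact: measurable_cell.
Qed.

Lemma cvg_right_step (g : R -> R) (T s : R) : 0 < s -> s <= T ->
  g u @[u --> s^'+] --> g s ->
  right_step g (T / n.+1%:R) n.+1 s @[n --> \oo] --> g s.
Proof.
move=> s0 sT gs; have T0 : 0 < T by exact: lt_le_trans sT.
apply/cvgrPdist_lt => e e0.
have /cvgrPdist_lt/(_ e e0)/nbhs_ballP[dl /= dl0 H] := gs.
near=> n.
have h0 : 0 < T / n.+1%:R by rewrite divr_gt0.
have hn : T / n.+1%:R < dl.
  rewrite ltr_pdivrMr// mulrC -ltr_pdivrMr//; near: n.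
  exists (Num.bound (T / dl)) => // n /= bn.
  apply: (@lt_le_trans _ _ (Num.bound (T / dl))%:R).
    by rewrite archi_boundP// divr_ge0 ?ltW.
  by rewrite ler_nat (leq_trans bn).
have [k kn ks] : exists2 k, (k < n.+1)%N & cell (T / n.+1%:R) k s.
  by apply: cell_ex => //; rewrite mulrC divfK.
rewrite (right_stepE g h0 kn ks).
move: ks; rewrite in_cell => /andP[k1]; rewrite le_eqVlt => /predU1P[<-|k2].
  by rewrite subrr normr0.
apply: H => //=; rewrite /ball/= distrC gtr0_norm ?subr_gt0//.
by rewrite -natr1 mulrDl mul1r (le_lt_trans _ hn)// lerBlDr addrC lerD2l ltW.
Unshelve. all: by end_near. Qed.

Lemma right_step_bound (g : R -> R) (T M : R) n s : 0 < T -> 0 < s -> s <= T ->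
  (forall u, 0 <= u -> u <= T -> `|g u| <= M) ->
  `|right_step g (T / n.+1%:R) n.+1 s| <= M.
Proof.
move=> T0 s0 sT gM; have h0 : 0 < T / n.+1%:R by rewrite divr_gt0.
have [k kn ks] : exists2 k, (k < n.+1)%N & cell (T / n.+1%:R) k s.
  by apply: cell_ex => //; rewrite mulrC divfK.
rewrite (right_stepE g h0 kn ks); apply: gM; first by rewrite mulr_ge0// ltW.
by rewrite mulrA ler_pdivrMr// mulrC ler_wpM2l ?ler_nat// ltW.
Qed.

Context (g : R -> R) (T M : R).
Hypotheses (T0 : 0 < T)
  (gr : forall s, 0 <= s -> g u @[u --> s^'+] --> g s)
  (gM : forall u, 0 <= u -> u <= T -> `|g u| <= M).
Let D : set R := `]0, T]%classic.

Let DE s : D s -> 0 < s <= T. Proof. by rewrite /D/= in_itv. Qed.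

Let muD : (mu D < +oo)%E.
Proof. by rewrite /D lebesgue_measure_itv/= lte_fin T0 -EFinB ltry. Qed.

Lemma measurable_right_cont : measurable_fun D g.
Proof.
apply: (@measurable_fun_cvg _ _ _ _ (fun n => right_step g (T / n.+1%:R) n.+1)).
  by move=> n; exact: measurable_right_step.
by move=> s /DE/andP[s0 sT]; apply: cvg_right_step => //; apply: gr; exact: ltW.
Qed.

Lemma integrable_right_cont : mu.-integrable D (EFin \o g).
Proof.
apply: measurable_bounded_integrable; [exact: measurable_itv|exact: muD|exact: measurable_right_cont|].
exists M; split; first exact: num_real.
by move=> N MN x /DE/andP[/ltW x0 xT] /=; rewrite (le_trans (gM _ _))// ltW.
Qed.

Lemma integrable_right_step n :
  mu.-integrable D (EFin \o right_step g (T / n.+1%:R) n.+1).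
Proof.
apply: measurable_bounded_integrable; [exact: measurable_itv|exact: muD|exact: measurable_right_step|].
exists M; split; first exact: num_real.
move=> N MN x /DE/andP[x0 xT] /=.
by rewrite (le_trans (right_step_bound n T0 x0 xT gM))// ltW.
Qed.

(** Dominated convergence, the step functions being bounded by the same constant [M] as [g]. *)
Lemma cvg_right_step_L1 :
  \int[mu]_(s in D) `|right_step g (T / n.+1%:R) n.+1 s - g s| @[n --> \oo] --> 0.
Proof.
have [_ h _] : [/\ mu.-integrable D (EFin \o g),
    (\int[mu]_(s in D) `|(right_step g (T / n.+1%:R) n.+1 s)%:E - (g s)%:E|)%E @[n --> \oo] --> 0%E
  & (\int[mu]_(s in D) (right_step g (T / n.+1%:R) n.+1 s)%:E)%E @[n --> \oo] -->
    (\int[mu]_(s in D) (g s)%:E)%E].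
  apply: (@dominated_convergence _ _ _ mu D _
    (fun n s => (right_step g (T / n.+1%:R) n.+1 s)%:E) (EFin \o g) (fun=> M%:E)).
  - exact: measurable_itv.
  - by move=> n; apply: measurableT_comp => //; exact: measurable_right_step.
  - by apply: measurableT_comp => //; exact: measurable_right_cont.
  - apply: aeW => s /DE/andP[s0 sT]; apply: cvg_EFin.
      by near=> n.
    by apply: cvg_right_step => //; apply: gr; exact: ltW.
  - apply: (@measurable_bounded_integrable _ _ _ _ (cst M)).
    + exact: measurable_itv.
    + exact: muD.
    + exact: measurable_cst.
    + exists `|M|; split; first exact: num_real.
      by move=> N MN x _ /=; exact: ltW.
  - apply: aeW => s n /DE/andP[s0 sT].
    by rewrite lee_fin; exact: right_step_bound.
exact: (fine_cvg h).
Unshelve. all: by end_near. Qed.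

Let integrable_oc (f : R -> R) t : t <= T -> mu.-integrable D (EFin \o f) ->
  mu.-integrable `]0, t]%classic (EFin \o f).
Proof.
move=> tT; apply: integrableS; [exact: measurable_itv|exact: measurable_itv|].
by move=> s; rewrite /D/= !in_itv/= => /andP[-> st]; exact: le_trans tT.
Qed.

Lemma Rintegral_cell_telescope (f : R -> R) (h : R) k : 0 <= h -> k.+1%:R * h <= T ->
  mu.-integrable D (EFin \o f) ->
  \int[mu]_(s in `]0, k.+1%:R * h]) f s - \int[mu]_(s in `]0, k%:R * h]) f s =
  \int[mu]_(s in cell h k) f s.
Proof.
move=> h0 kT mf; rewrite Rintegral_itvB//.
- exact: integrable_oc.
- by rewrite bnd_simp mulr_ge0.
- by rewrite bnd_simp ler_wpM2r// ler_nat.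
Qed.

Lemma Rintegral_sum_cell (f : R -> R) (h : R) m : 0 <= h -> m%:R * h <= T ->
  mu.-integrable D (EFin \o f) ->
  \sum_(k < m) \int[mu]_(s in cell h k) f s = \int[mu]_(s in `]0, m%:R * h]) f s.
Proof.
move=> h0 + mf; elim: m => [|m ih] mT.
  by rewrite big_ord0 mul0r set_itvoc0 Rintegral_set0.
rewrite big_ord_recr/= ih; last by rewrite (le_trans _ mT)// ler_wpM2r// ler_nat.
by rewrite -(Rintegral_cell_telescope h0 mT mf) addrC subrK.
Qed.

Lemma Rintegral_cc_cell (h : R) k : 0 <= h -> k.+1%:R * h <= T ->
  \int[mu]_(s in `[0, k.+1%:R * h]) g s - \int[mu]_(s in `[0, k%:R * h]) g s =
  \int[mu]_(s in cell h k) g s.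
Proof.
move=> h0 kT; have ig := integrable_right_cont.
have kT' : k%:R * h <= T by rewrite (le_trans _ kT)// ler_wpM2r// ler_nat.
rewrite -(Rintegral_cell_telescope h0 kT ig); congr (_ - _).
  rewrite Rintegral_itv_obnd_cbnd//.
  exact: integrable_oc.
rewrite Rintegral_itv_obnd_cbnd//.
exact: integrable_oc.
Qed.

(** The absolute values stay inside the sum because the cell errors are later weighted by varying
    vectors. The sum is at most the [L^1] distance from [g] to its step function. *)
Lemma cvg_right_riemann :
  \sum_(k < n.+1) `|\int[mu]_(s in cell (T / n.+1%:R) k) g s -
     T / n.+1%:R * g (k.+1%:R * (T / n.+1%:R))| @[n --> \oo] --> 0.
Proof.
apply: (squeeze_cvgr _ (cvg_cst 0) cvg_right_step_L1); near=> n.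
rewrite sumr_ge0//=; set h := T / n.+1%:R.
have h0 : 0 < h by rewrite divr_gt0.
have Th : n.+1%:R * h = T by rewrite mulrC divfK.
have ig := integrable_right_cont; have is_ := integrable_right_step n.
have isg : mu.-integrable D (EFin \o (fun s => right_step g h n.+1 s - g s)).
  rewrite (_ : EFin \o _ = (fun s => (EFin \o right_step g h n.+1) s - (EFin \o g) s)%E)//.
  by apply: integrableB => //; exact: measurable_itv.
have iabs : mu.-integrable D (EFin \o (fun s => `|right_step g h n.+1 s - g s|)).
  exact: (integrable_abse isg).
have -> : D = `]0, n.+1%:R * h]%classic by rewrite Th.
rewrite -(Rintegral_sum_cell (ltW h0) _ iabs) ?Th//; apply: ler_sum => k _.
have cD : cell h k `<=` D.
  move=> s; rewrite /D /cell/= !in_itv/= => /andP[s1 s2]; apply/andP; split.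
    by apply: le_lt_trans s1; rewrite mulr_ge0// ltW.
  by apply: le_trans s2 _; rewrite -[leRHS]Th ler_wpM2r ?ler_nat// ltW.
have mc := @measurable_cell h k.
have icell f : mu.-integrable D (EFin \o f) -> mu.-integrable (cell h k) (EFin \o f).
  move=> i_f; apply: (@integrableS _ _ _ mu D (cell h k)) => //; exact: measurable_itv.
apply: (le_trans _ (le_normr_Rintegral _ (icell _ isg))); last exact: measurable_itv.
rewrite RintegralB; [|exact: measurable_itv|exact: icell|exact: icell].
rewrite distrC le_eqVlt; apply/orP; left; apply/eqP; congr (`|_ - _|).
rewrite (@eq_Rintegral _ _ _ mu _ (fun=> g (k.+1%:R * h))); last first.
  by move=> s /set_mem ks; rewrite (right_stepE g h0 _ ks).
rewrite Rintegral_cst; last exact: measurable_itv.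
by rewrite [X in fine X](mu_cell k h0) mulrC.
Unshelve. all: by end_near. Qed.

End right_riemann.

(** The one-sided limits and the value at a point bound the path nearby; compactness of [[0, T]]
    makes the bound uniform. *)
Lemma cadlag_bounded (R : realType) d (p : R -> 'cV[R]_d) T : cadlag p ->
  exists M, forall s, 0 <= s -> s <= T -> `|p s| <= M.
Proof.
move=> cp.
have /compact_near_coveringP cov := @segment_compact R 0 T.
have loc x : 0 <= x -> exists dl K, 0 < dl /\
    forall s, 0 <= s -> `|x - s| < dl -> `|p s| <= K.
  move=> x0; have [cr cl] := cp x x0.
  have : \forall s \near x^'+, `|p s| < `|p x| + 1.
    by apply: (cvgr_norm_lt _ cr); rewrite ltrDl.
  move=> /nbhs_ballP[d1 /= d10 H1].
  have [d2 [K2 [d20 H2]]] : exists d2 K2 : R, 0 < d2 /\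
      forall s, 0 <= s -> s < x -> `|x - s| < d2 -> `|p s| <= K2.
    (* At [x = 0] no nonnegative time lies to the left, and the bound on that side is vacuous. *)
    have [x_gt0|] := ltP 0 x; last first.
      move=> x_le0; exists 1, 0; split => // s s0 sx _.
      by move: (lt_le_trans sx x_le0); rewrite ltNge s0.
    have /cvg_ex[/= l cl'] := cl x_gt0.
    have : \forall s \near x^'-, `|p s| < `|l| + 1.
      by apply: (cvgr_norm_lt _ cl'); rewrite ltrDl.
    move=> /nbhs_ballP[d2 /= d20 H2]; exists d2, (`|l| + 1); split => // s s0 sx xs.
    by apply/ltW/H2.
  exists (Num.min d1 d2), (Num.max K2 (`|p x| + 1)); split; first by rewrite lt_min d10 d20.
  move=> s s0; rewrite lt_min => /andP[h1 h2]; rewrite le_max.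
  have [sx|xs|<-] := ltgtP s x; first by rewrite H2.
    by rewrite orbC ltW//; apply: H1.
  by rewrite lerDl ler01 orbT.
have : \forall M \near +oo, `[0, T] `<=` (fun s => 0 <= s -> `|p s| <= M).
  apply: (cov R (pinfty_nbhs R) (fun M s => 0 <= s -> `|p s| <= M)) => x.
  rewrite /= in_itv/= => /andP[x0 xT]; have [dl [K [dl0 H]]] := loc x x0.
  exists (ball x dl, [set M | K <= M]).
    by split; [exact: nbhsx_ballx|apply: nbhs_pinfty_ge; rewrite num_real].
  move=> [s M] [/= xs KM] s0; apply: le_trans KM; exact: H.
move=> [M [_ HM]]; exists (M + 1) => s s0 sT.
by apply: (HM (M + 1)) => //; rewrite ?ltrDl//= in_itv/= s0.
Unshelve. all: by end_near. Qed.

(** * The implicit Euler scheme *)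

Lemma mulr_natS (R : realType) j (c : R) : j.+1%:R * c = c + j%:R * c.
Proof. by rewrite -natr1 mulrDl mul1r addrC. Qed.

Section resolvent.
Context (R : realType) (d : nat).
Implicit Types (M A : 'M[R]_d) (v xi : 'cV[R]_d).

Lemma mulmx_dotp M v i : (M *m v) i 0 = dotp (row i M)^T v.
Proof. by rewrite mxE; apply: eq_bigr => j _; rewrite !mxE. Qed.

Lemma mx_norm_coord m n (M : 'M[R]_(m, n)) i j : `|M i j| <= `|M|.
Proof.
rewrite {2}/Num.norm/= mx_normrE.
exact: (@le_bigmax _ _ _ 0 (fun ij : 'I_m * 'I_n => `|M ij.1 ij.2|) (i, j)).
Qed.

Lemma mulmx_norm_le M v : `|M *m v| <= d%:R * `|M| * `|v|.
Proof.
apply: cV_norm_le => [|i]; first by rewrite !mulr_ge0.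
rewrite mxE (le_trans (ler_norm_sum _ _ _))// -mulrA.
rewrite -[X in _ <= X%:R * _]card_ord mulr_natl -sumr_const.
by apply: ler_sum => j _; rewrite normrM ler_pM// mx_norm_coord.
Qed.

(** The inverse of the transposed Euler matrix: the scheme is read on frequencies, by duality. *)
Definition resolvent A h : 'M[R]_d := invmx (1%:M - h *: A^T).

(** Symmetric in [A] and its transpose, so that one constant serves both. *)
Definition mx_bound A : R := d%:R * (`|A| + `|A^T|).

Lemma mx_bound_ge0 A : 0 <= mx_bound A.
Proof. by rewrite mulr_ge0// addr_ge0. Qed.

Lemma mulmx_bound A v : `|A *m v| <= mx_bound A * `|v|.
Proof.
by rewrite (le_trans (mulmx_norm_le _ _))// ler_wpM2r// ler_wpM2l// lerDl.
Qed.

Lemma trmx_bound A : mx_bound A^T = mx_bound A.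
Proof. by rewrite /mx_bound trmxK addrC. Qed.

Lemma euler_ge A h v : 0 <= h ->
  (1 - h * mx_bound A) * `|v| <= `|(1%:M - h *: A) *m v|.
Proof.
move=> h0; rewrite mulmxBl mul1mx -scalemxAl mulrBl mul1r.
apply: le_trans (lerB_dist _ _); rewrite lerB// normrZ ger0_norm// -mulrA ler_wpM2l//.
exact: mulmx_bound.
Qed.

Lemma euler_le A h v : 0 <= h ->
  `|(1%:M - h *: A) *m v| <= (1 + h * mx_bound A) * `|v|.
Proof.
move=> h0; rewrite mulmxBl mul1mx -scalemxAl mulrDl mul1r.
apply: le_trans (ler_normB _ _) _; rewrite lerD// normrZ ger0_norm// -mulrA ler_wpM2l//.
exact: mulmx_bound.
Qed.

Context (A : 'M[R]_d) (h : R).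
Hypotheses (h0 : 0 <= h) (hA : h * mx_bound A <= 2^-1).

(** By [euler_ge], [1 - h A] shrinks norms by at most the factor 1/2, so it has trivial kernel; a
    left null vector of its transpose would be such a kernel vector. *)
Lemma euler_unit : 1%:M - h *: A^T \in unitmx.
Proof.
rewrite unitmxE unitfE; apply/negP => /det0P[v v0 vM].
have : (1%:M - h *: A) *m v^T = 0.
  by apply: trmx_inj; rewrite trmx_mul trmxK linearB/= linearZ/= trmx1 vM trmx0.
move=> /(congr1 (fun u : 'cV[R]_d => `|u|)); rewrite normr0 => e0.
have := euler_ge A v^T h0; rewrite e0.
have [v'0|] := eqVneq v^T 0; first by rewrite -[v]trmxK v'0 trmx0 eqxx in v0.
rewrite -normr_gt0 => v'0; apply/negP; rewrite -ltNge mulr_gt0//.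
by move: hA; lra.
Qed.

Lemma resolventK v : (1%:M - h *: A^T) *m (resolvent A h *m v) = v.
Proof. by rewrite mulmxA mulmxV ?mul1mx// euler_unit. Qed.

Lemma resolvent_le v : `|resolvent A h *m v| <= expR (2 * (h * mx_bound A)) * `|v|.
Proof.
have := euler_ge A^T (resolvent A h *m v) h0; rewrite resolventK trmx_bound => H.
pose a := h * mx_bound A; have a0 : 0 <= a := mulr_ge0 h0 (mx_bound_ge0 A).
have ha : a <= 2^-1 := hA.
rewrite -/a in H *; pose r := `|resolvent A h *m v|; rewrite -/r in H *.
have r0 : 0 <= r by exact: normr_ge0.
have a1 : 0 <= 1 - a by lra.
(* For [0 <= a <= 1/2] one has [(1 + 2 a) (1 - a) = 1 + a (1 - 2 a) >= 1]. *)
apply: (@le_trans _ _ ((1 + 2 * a) * ((1 - a) * r))); last first.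
  apply: ler_pM => //; [lra|exact: mulr_ge0|exact: expR_ge1Dx].
have : 0 <= a * (1 - 2 * a) * r by rewrite !mulr_ge0//; lra.
lra.
Qed.

Lemma resolvent_ge v : expR (- (h * mx_bound A)) * `|v| <= `|resolvent A h *m v|.
Proof.
have := euler_le A^T (resolvent A h *m v) h0; rewrite resolventK trmx_bound => H.
rewrite expRN ler_pdivrMl ?expR_gt0// (le_trans H)// ler_wpM2r//.
exact: expR_ge1Dx.
Qed.

Definition dual_euler xi j := iter j (mulmx (resolvent A h)) xi.

Lemma dual_eulerS xi j : (1%:M - h *: A^T) *m dual_euler xi j.+1 = dual_euler xi j.
Proof. exact: resolventK. Qed.

Lemma dual_euler_le xi j :
  `|dual_euler xi j| <= expR (j%:R * (2 * (h * mx_bound A))) * `|xi|.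
Proof.
elim: j => [|j ih]; first by rewrite mul0r expR0 mul1r.
apply: le_trans (resolvent_le _) _; rewrite [j.+1%:R * _]mulr_natS expRD -mulrA.
by rewrite ler_wpM2l ?expR_ge0.
Qed.

Lemma dual_euler_ge xi j :
  expR (- (j%:R * (h * mx_bound A))) * `|xi| <= `|dual_euler xi j|.
Proof.
elim: j => [|j ih]; first by rewrite mul0r oppr0 expR0 mul1r.
apply: (le_trans _ (resolvent_ge _)).
by rewrite [j.+1%:R * _]mulr_natS opprD expRD -mulrA ler_wpM2l ?expR_ge0.
Qed.

End resolvent.

Section euler_path.
Context (R : realType) (d : nat) (A : 'M[R]_d) (p l : R -> 'cV[R]_d) (x : 'cV[R]_d).
Notation mu := (@lebesgue_measure R).
Hypotheses (cp : cadlag p) (l0 : l 0 = 0)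
  (pE : forall t, 0 <= t ->
    p t = x + (\col_i \int[mu]_(s in `[0, t]) ((A *m p s) i 0)) + l t).
Context (T : R).
Hypothesis T0 : 0 < T.

(** The local error of the scheme: drift integral over a cell minus its right-endpoint
    quadrature. *)
Definition euler_err h k : 'cV[R]_d :=
  \col_i (\int[mu]_(s in cell h k) ((A *m p s) i 0) - h * (A *m p (k.+1%:R * h)) i 0).

Let gr i s : 0 <= s -> (A *m p u) i 0 @[u --> s^'+] --> (A *m p s) i 0.
Proof.
move=> s0; have [cr _] := cp s0; rewrite mulmx_dotp; under eq_fun do rewrite mulmx_dotp.
have H := continuous_cvg _ (@continuous_dotp R d (row i A)^T (p s)) cr.
by apply: H.
Qed.

Let gM i : exists M : R, forall s : R, 0 <= s -> s <= T -> `|(A *m p s) i 0| <= M.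
Proof.
have [M pM] := cadlag_bounded T cp; exists (d%:R * `|A| * M) => s s0 sT.
rewrite (le_trans (cV_norm_coord _ _))// (le_trans (mulmx_norm_le _ _))//.
by rewrite ler_wpM2l ?mulr_ge0// pM.
Qed.

Lemma euler_step h k : 0 <= h -> k.+1%:R * h <= T ->
  (1%:M - h *: A) *m p (k.+1%:R * h) =
  p (k%:R * h) + (l (k.+1%:R * h) - l (k%:R * h)) + euler_err h k.
Proof.
move=> h0 kT; rewrite mulmxBl mul1mx -scalemxAl.
pose I t : 'cV[R]_d := \col_i \int[mu]_(s in `[0, t]) ((A *m p s) i 0).
have -> : euler_err h k =
    I (k.+1%:R * h) - I (k%:R * h) - h *: (A *m p (k.+1%:R * h)).
  apply/colP => i; have [M hM] := gM i.
  have := Rintegral_cc_cell T0 (gr (i := i)) hM h0 kT.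
  have E3 (u v w : 'cV[R]_d) : (u - v - h *: w) i 0 = u i 0 - v i 0 - h * w i 0.
    by rewrite !mxE.
  have EI t : I t i 0 = \int[mu]_(s in `[0, t]) ((A *m p s) i 0) by rewrite mxE.
  by move=> IE; rewrite [LHS]mxE -IE E3 !EI.
set q := h *: _.
rewrite {1}(pE (mulr_ge0 (ler0n _ k.+1) h0)) (pE (mulr_ge0 (ler0n _ k) h0)).
rewrite -/(I _) -/(I _); move: (I _) (I _) (l _) (l _) q => u v w y q.
by apply/colP => i; rewrite !mxE; ring.
Qed.

Lemma path0 : p 0 = x.
Proof.
rewrite pE// l0 addr0; apply/colP => i; rewrite mxE [X in _ + X]mxE.
by rewrite set_itv1 Rintegral_set1 addr0.
Qed.

(** Summation by duality: [1 - h A] acting on the path in [euler_step] moves to the dual vector and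
    lowers its index by one, by [dual_eulerS]. *)
Lemma euler_telescope h N xi k : 0 <= h -> h * mx_bound A <= 2^-1 ->
  N%:R * h <= T -> (k <= N)%N ->
  dotp (dual_euler A h xi (N - k)) (p (k%:R * h)) = dotp (dual_euler A h xi N) x +
  \sum_(i < k) (dotp (dual_euler A h xi (N - i)) (l (i.+1%:R * h) - l (i%:R * h)) +
                dotp (dual_euler A h xi (N - i)) (euler_err h i)).
Proof.
move=> h0 hA NT; elim: k => [|k ih] kN.
  by rewrite big_ord0 addr0 subn0 mul0r path0.
have kT : k.+1%:R * h <= T by rewrite (le_trans _ NT)// ler_wpM2r// ler_nat.
rewrite big_ord_recr/= addrA -ih ?(ltnW kN)// -!dotpDr addrA -euler_step// dotp_mulmx.
rewrite -[in RHS](subnSK kN); congr dotp.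
by rewrite linearB/= linearZ/= trmx1 dual_eulerS.
Qed.

Definition euler_sum h N xi :=
  \sum_(i < N) dotp (dual_euler A h xi (N - i)) (l (i.+1%:R * h) - l (i%:R * h)).

Lemma cvg_euler xi :
  dotp (dual_euler A (T / n.+1%:R) xi n.+1) x + euler_sum (T / n.+1%:R) n.+1 xi
    @[n --> \oo] --> dotp xi (p T).
Proof.
pose a := mx_bound A; have a0 : 0 <= a := mx_bound_ge0 A.
(* The exponential bounds every dual vector used, since [j h <= T]; the factor [d] comes from
   [dotp_norm]. *)
pose K := d%:R * (expR (T * (2 * a)) * `|xi|).
pose r i n := \sum_(k < n.+1) `|\int[mu]_(s in cell (T / n.+1%:R) k) ((A *m p s) i 0) -
     T / n.+1%:R * (A *m p (k.+1%:R * (T / n.+1%:R))) i 0|.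
have K0 : 0 <= K by rewrite mulr_ge0// mulr_ge0// expR_ge0.
apply/cvgrPdist_le => e e0.
(* The [d] coordinates each contribute at most [K e'], in total at most [e]. *)
pose e' := e / (K * d%:R + 1).
have Kd0 : 0 < K * d%:R + 1 by rewrite ltr_wpDl// mulr_ge0.
have e'0 : 0 < e' by rewrite divr_gt0.
have Hr : \forall n \near \oo, forall i : 'I_d, r i n < e'.
  apply: filter_forall => i; have [M hM] := gM i.
  exact: (cvgr_lt _ (cvg_right_riemann T0 (gr (i := i)) hM) _ e'0).
near=> n.
have Hrn : forall i : 'I_d, r i n < e' by near: n; exact: Hr.
pose h := T / n.+1%:R; have h0 : 0 <= h by rewrite divr_ge0// ltW.
have Nh : n.+1%:R * h = T by rewrite mulrC divfK.
have ha : h * a <= 2^-1.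
  rewrite /h mulrAC ler_pdivrMr// [2^-1 * _]mulrC ler_pdivlMr//; near: n.
  exists (Num.bound (T * a * 2)) => // n /= bn.
  apply: (@le_trans _ _ (Num.bound (T * a * 2))%:R).
    by rewrite ltW// archi_boundP// mulr_ge0// mulr_ge0// ltW.
  by rewrite ler_nat (leq_trans bn).
have := @euler_telescope h n.+1 xi n.+1 h0 ha _ (leqnn _); rewrite Nh => /(_ (lexx _)).
rewrite subnn {1}/dual_euler/= => ->; rewrite big_split/= -/(euler_sum h n.+1 xi) -/h.
have cancel3 (c S E : R) : c + (S + E) - (c + S) = E by ring.
rewrite cancel3 (le_trans (ler_norm_sum _ _ _))//.
apply: (@le_trans _ _ (K * \sum_(i < d) r i n)).
  rewrite /r exchange_big/= mulr_sumr; apply: ler_sum => k _.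
  apply: (le_trans (dotp_norm _ _)); rewrite /K -!mulrA; apply: ler_wpM2l => //.
  rewrite mulrA; apply: ler_pM => //.
    apply: (le_trans (dual_euler_le h0 ha _ _)); apply: ler_wpM2r => //.
    rewrite ler_expR [_ * (2 * _)]mulrCA [T * _]mulrCA ler_pM2l// mulrA ler_wpM2r//.
    by rewrite -[leRHS]Nh ler_wpM2r// ler_nat leq_subr.
  apply: cV_norm_le => [|i]; first by rewrite sumr_ge0.
  rewrite mxE (bigD1 i)//= lerDl; exact: sumr_ge0.
apply: (@le_trans _ _ (K * (d%:R * e'))).
  rewrite ler_wpM2l// mulr_natl -[in leRHS](card_ord d) -sumr_const ler_sum// => i _.
  exact: ltW.
rewrite /e' !mulrA ler_pdivrMr// mulrDr mulr1; move: (ltW e0); lra.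
Unshelve. all: by end_near. Qed.

End euler_path.

(** * Characteristic function of the solution *)

Section ou_charf.
Context (R : realType) (d : nat) (d0 : measure_display).
Context (Omega : measurableType d0) (P : probability Omega R).
Context (A : 'M[R]_d) (L : R -> Omega -> 'cV[R]_d).
Hypothesis hL : levy_process P L.
Context (alpha c1 c2 : R).
Hypotheses (alpha0 : 0 < alpha) (c10 : 0 < c1) (c20 : 0 <= c2).
Hypothesis decay : forall xi t, 0 <= t ->
  cf2 P (fun w => dotp xi (L t w)) <= expR (t * (c2 - c1 * `|xi| `^ alpha)).

(** Over a period of length at most 1 the dual vectors keep at least the fraction
    [exp(- mx_bound A)] of [|xi|]. *)
Let kappa := expR (- mx_bound A) `^ alpha.

Lemma cf2_euler_sum_le tau n p xi : 0 < tau -> tau <= 1 -> (0 < p)%N ->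
  tau / n.+1%:R * mx_bound A <= 2^-1 ->
  cf2 P (fun w => euler_sum A (fun s => L s w) (tau / n.+1%:R) (p * n.+1) xi) <=
  expR (tau * (c2 - c1 * kappa * `|xi| `^ alpha)).
Proof.
move=> tau0 tau1 p0 ha; set h := tau / n.+1%:R in ha *.
have h0 : 0 < h by rewrite divr_gt0.
pose N := (p * n.+1)%N; pose f j := cf2 P (fun w => dotp (dual_euler A h xi j) (L h w)).
rewrite (cf2_levy_sum hL N (fun i => dual_euler A h xi (N - i)) (ltW h0)).
(* After reversal [j] counts steps back from the final time, so the last period is the initial block
   [j < n.+1]. *)
rewrite (reindex_inj rev_ord_inj)/=.
have -> : \prod_(j < N) cf2 P (fun w => dotp (dual_euler A h xi (N - (N - j.+1))) (L h w)) =
    \prod_(0 <= j < N) f j.+1.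
  by rewrite big_mkord; apply: eq_bigr => j _; rewrite /f subKn.
have f0 j : 0 <= f j by exact: cf2_ge0.
have f1 j : f j <= 1.
  apply: cf2_le1; apply: measurableT_comp; first exact: measurable_dotp.
  by apply: levy_measurable hL _ _; exact: ltW.
rewrite (@big_cat_nat _ _ _ n.+1)//=; last by rewrite leq_pmull.
(* All factors before the last period are bounded by 1. *)
apply: (@le_trans _ _ (\prod_(0 <= j < n.+1) f j.+1)).
  apply: ler_piMr; first by apply: prodr_ge0 => j _.
  by apply: Num.Theory.prodr_ile1 => j _; rewrite f0 f1.
have -> : expR (tau * (c2 - c1 * kappa * `|xi| `^ alpha)) =
    \prod_(0 <= j < n.+1) expR (h * (c2 - c1 * kappa * `|xi| `^ alpha)).
  rewrite prodr_const_nat subn0 -expRM_natl; congr expR.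
  by rewrite mulrA; congr (_ * _); rewrite /h mulrC divfK.
rewrite !big_mkord; apply: ler_prod => j _; rewrite f0/=.
apply: le_trans (decay _ (ltW h0)) _.
rewrite ler_expR ler_wpM2l ?(ltW h0)// lerB// -mulrA ler_wpM2l ?(ltW c10)//.
rewrite -powRM ?expR_ge0// ge0_ler_powR ?nnegrE ?(ltW alpha0) ?mulr_ge0 ?expR_ge0//.
apply: le_trans (dual_euler_ge (ltW h0) ha xi j.+1).
rewrite ler_wpM2r// ler_expR lerN2 mulrA ler_piMl ?mx_bound_ge0//.
by rewrite /h mulrA ler_pdivrMr// mul1r -[leRHS]mulr1 ler_pM ?ler_nat// ltW.
Qed.

Context (x : 'cV[R]_d) (X : R -> Omega -> 'cV[R]_d).
Hypothesis hX : ou_solution P A L x X.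

(** By [cvg_euler] and dominated convergence the integral is a limit of the same integral for Euler
    sums; the deterministic contribution [c n] of the starting point joins the phase, which
    [cf2_cosB] disregards. *)
Lemma ou_cos_sqr_le tau p xi y : 0 < tau -> tau <= 1 -> (0 < p)%N ->
  (\int[P]_w cos (dotp xi (X (p%:R * tau) w) - y)) ^+ 2 <=
  expR (tau * (c2 - c1 * kappa * `|xi| `^ alpha)).
Proof.
move=> tau0 tau1 p0; set B := expR _.
have T0 : 0 < p%:R * tau by rewrite mulr_gt0// ltr0n.
pose h n := tau / n.+1%:R.
pose S n w := euler_sum A (fun s => L s w) (h n) (p * n.+1) xi.
pose c n := dotp (dual_euler A (h n) xi (p * n.+1)) x.
have h0 n : 0 < h n by rewrite divr_gt0.
have mS n : measurable_fun setT (S n).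
  apply: measurable_sum => i; apply: measurableT_comp; first exact: measurable_dotp.
  by apply: measurable_levy_incr hL _ _ _ _; rewrite mulr_ge0// ltW.
have mX : measurable_fun setT (fun w => dotp xi (X (p%:R * tau) w)).
  apply: measurableT_comp; first exact: measurable_dotp.
  by apply: ou_measurable hX _ _; exact: ltW.
pose u n := \int[P]_w cos (S n w - (y - c n)).
have cu : u n @[n --> \oo] --> \int[P]_w cos (dotp xi (X (p%:R * tau) w) - y).
  have [_ _ H] : [/\ P.-integrable setT (fun w => (cos (dotp xi (X (p%:R * tau) w) - y))%:E),
    (\int[P]_w `|(cos (S n w - (y - c n)))%:E - (cos (dotp xi (X (p%:R * tau) w) - y))%:E|)%E
      @[n --> \oo] --> 0%E
  & (\int[P]_w (cos (S n w - (y - c n)))%:E)%E @[n --> \oo] -->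
    (\int[P]_w (cos (dotp xi (X (p%:R * tau) w) - y))%:E)%E].
    apply: (@dominated_convergence _ _ _ P setT _ (fun n w => (cos (S n w - (y - c n)))%:E)
      _ (fun=> 1%:E)).
    - exact: measurableT.
    - move=> n; apply: measurableT_comp => //.
      by have [] := bmeas_cos (measurable_funB (mS n) (measurable_cst (y - c n))).
    - apply: measurableT_comp => //.
      by have [] := bmeas_cos (measurable_funB mX (measurable_cst y)).
    - apply: filterS3 (levy_start hL) (ou_cadlag hX) (ou_equation hX) => w L0 cX eX _.
      apply: cvg_EFin; first by near=> n.
      have E := @cvg_euler _ _ A _ (fun s => L s w) _ cX L0 eX _ T0 xi.
      (* Only step numbers divisible by [p] are used, so that the last period of length [tau]
         consists of exactly [n.+1] steps. *)
      pose phi n := (p * n.+1).-1.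
      have phiS n : (phi n).+1 = (p * n.+1)%N by rewrite prednK// muln_gt0 p0.
      have phioo : phi n @[n --> \oo] --> \oo.
        move=> U [N _ NU]; exists N => // n /= Nn; apply: NU => /=.
        by rewrite -ltnS phiS (leq_trans _ (leq_pmull _ p0)).
      have hE n : p%:R * tau / (p * n.+1)%:R = h n.
        by rewrite /h natrM; field; rewrite !gt_eqF// ltr0n.
      have E' : c n + S n w @[n --> \oo] --> dotp xi (X (p%:R * tau) w).
        rewrite [X in X @ _ --> _](_ : _ = (fun m =>
            dotp (dual_euler A (p%:R * tau / m.+1%:R) xi m.+1) x +
            euler_sum A (fun s => L s w) (p%:R * tau / m.+1%:R) m.+1 xi) \o phi).
          exact: (cvg_comp _ _ phioo E).
        by apply/funext => n; rewrite /comp phiS hE.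
      have E2 : c n + S n w - y @[n --> \oo] --> dotp xi (X (p%:R * tau) w) - y.
        by apply: cvgB => //; exact: cvg_cst.
      have H := continuous_cvg _ (@continuous_cos R _) E2.
      rewrite [X in X @ _ --> _](_ : _ = cos \o (fun n => c n + S n w - y)); first exact: H.
      by apply/funext => n /=; congr cos; rewrite opprB addrA [S n w + _]addrC.
    - by apply: bmeas_integrable; exact: bmeas_cst.
    - by apply: aeW => w n _; rewrite lee_fin cos_max.
  move: H; rewrite -[X in _ --> X]fineK; last first.
    apply: integrable_fin_num => //; apply: bmeas_integrable; apply: bmeas_cos.
    exact: measurable_funB.
  by move=> H; exact: (fine_cvg H).
move: cu; set I0 := \int[P]_w cos _ => cu.
have cu2 : u n * u n @[n --> \oo] --> I0 * I0 by exact: (cvgM cu cu).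
rewrite expr2; apply: (@cvgr_to_le _ _ _ _ _ _ _ cu2); near=> n.
have ha : h n * mx_bound A <= 2^-1.
  rewrite /h mulrAC ler_pdivrMr// [2^-1 * _]mulrC ler_pdivlMr//; near: n.
  exists (Num.bound (tau * mx_bound A * 2)) => // n /= bn.
  apply: (@le_trans _ _ (Num.bound (tau * mx_bound A * 2))%:R).
    by rewrite ltW// archi_boundP// mulr_ge0// mulr_ge0 ?mx_bound_ge0// ltW.
  by rewrite ler_nat (leq_trans bn).
rewrite /= -expr2; apply: le_trans (cf2_euler_sum_le xi tau0 tau1 p0 ha).
exact: cf2_cosB.
Unshelve. all: by end_near. Qed.

End ou_charf.

(** * Probability of small cubes *)

Section stretched_sum.
Context (R : realType).

(* Telescoping: 1/(1+um)^2 <= (1/(1+u(m-1)) - 1/(1+um))/u. *)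
Lemma sum_inv_sqr_le (u : R) n : 0 < u ->
  \sum_(i < n.+1) (1 + u * i%:R) ^- 2 <= 1 + u^-1.
Proof.
move=> u0.
suff : \sum_(i < n.+1) (1 + u * i%:R) ^- 2 <= 1 + u^-1 * (1 - (1 + u * n%:R)^-1).
  move/le_trans; apply; rewrite lerD2l ler_piMr ?invr_ge0 ?(ltW u0)//.
  by rewrite gerDl oppr_le0 invr_ge0 addr_ge0// mulr_ge0// ltW.
elim: n => [|n ih]; first by rewrite big_ord_recr big_ord0/= mulr0 addr0 expr1n invr1 subrr mulr0 add0r addr0.
rewrite big_ord_recr/=; apply: le_trans (lerD ih (lexx _)) _.
have -> : 1 + u * n.+1%:R = 1 + u * n%:R + u by rewrite -natr1; ring.
set a := 1 + u * n%:R; have a0 : 0 < a by rewrite ltr_wpDr// mulr_ge0// ltW.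
have au0 : 0 < a + u by rewrite addr_gt0.
have -> : u^-1 * (1 - (a + u)^-1) = u^-1 * (1 - a^-1) + (a * (a + u))^-1.
  by field; rewrite !gt_eqF.
rewrite addrA lerD2l lef_pV2 ?posrE ?mulr_gt0 ?exprn_gt0// expr2.
by apply: ler_wpM2r; [exact: ltW|rewrite lerDl ltW].
Qed.

(** One term of the exponential series suffices: the power [j.+1] is chosen with [j.+1 * al >= 2],
    so that [(y^al)^(j.+1)] dominates [y^2] for [y > 1]. *)
Lemma expR_powR_le (al : R) : 0 < al -> exists2 K : R, 0 < K &
  forall y, 0 <= y -> expR (- (y `^ al)) <= K * (1 + y) ^- 2.
Proof.
move=> al0; pose j := Num.bound (2 / al).
have jal : 2 <= j.+1%:R * al.
  rewrite -ler_pdivrMr//; apply: (@le_trans _ _ j%:R); last by rewrite ler_nat.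
  by rewrite ltW// archi_boundP// divr_ge0// ltW.
exists (4 * j.+1`!%:R); first by rewrite mulr_gt0// ltr0n fact_gt0.
move=> y y0; have F1 : 1 <= j.+1`!%:R :> R by rewrite ler1n fact_gt0.
rewrite expRN -[leRHS]invrK lef_pV2 ?posrE ?expR_gt0 ?invr_gt0 ?mulr_gt0 ?invr_gt0 ?exprn_gt0 ?(lt_le_trans _ F1)//; last first.
  by rewrite ltr_wpDr.
rewrite invfM invrK.
have y1 : 0 < 1 + y by rewrite ltr_wpDr.
have p0 : 0 <= y `^ al by exact: powR_ge0.
have F0 : 0 < j.+1`!%:R :> R by exact: lt_le_trans F1.
rewrite mulrC ler_pdivrMr ?mulr_gt0//.
have [yle1|y_gt1] := leP y 1.
  have := expR_ge1Dx (y `^ al) => e1.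
  have : 4 <= expR (y `^ al) * (4 * j.+1`!%:R).
    rewrite mulrCA -[leLHS]mulr1 ler_pM// -[leLHS]mulr1 ler_pM//.
    by apply: le_trans e1; rewrite lerDl.
  by apply: le_trans; rewrite expr2; nra.
have e1 := expR_ge1Dxn j p0.
have : y ^+ 2 <= (y `^ al) ^+ j.+1.
  rewrite -powR_mulrn// -powR_mulrn// -powRrM ler_powR// ?(ltW y_gt1)//.
  by rewrite mulrC.
move=> h; have : y ^+ 2 <= expR (y `^ al) * j.+1`!%:R.
  apply: (le_trans h); rewrite -ler_pdivrMr//; apply: le_trans e1.
  by rewrite lerDr.
by rewrite mulrCA; nra.
Qed.

(** Writing [b i^al = (u i)^al] with [u = b^(1/al)] reduces to [sum_inv_sqr_le]. The resulting
    [b^(-1/al)], one factor per dimension, is the source of the rate [d / alpha]. *)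
Lemma sum_expR_powR_le (al : R) : 0 < al -> exists2 K : R, 0 < K &
  forall b n, 0 < b ->
  \sum_(i < n) expR (- (b * i%:R `^ al)) <= K * (1 + b `^ (- al^-1)).
Proof.
move=> al0; have [K K0 h] := expR_powR_le al0; exists K => // b n b0.
pose u := b `^ al^-1; have u0 : 0 < u by rewrite powR_gt0.
case: n => [|n]; first by rewrite big_ord0 mulr_ge0 ?addr_ge0 ?powR_ge0// ltW.
apply: (@le_trans _ _ (\sum_(i < n.+1) K * (1 + u * i%:R) ^- 2)).
  apply: ler_sum => i _; apply: le_trans (h _ _); last by rewrite mulr_ge0// ltW.
  by rewrite powRM// ?(ltW u0)// -powRrM mulVf ?gt_eqF// powRr1// ltW.
rewrite -mulr_sumr ler_wpM2l ?(ltW K0)// powRN; exact: sum_inv_sqr_le.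
Qed.

End stretched_sum.

(** With truncated subtraction the argument of [e] is the distance of [k] and [j], and each distance
    occurs at most twice. *)
Lemma sum_dist_le (R : realType) (e : nat -> R) N k : (forall m, 0 <= e m) -> (k < N)%N ->
  \sum_(j < N) e ((k - j) + (j - k))%N <= 2 * \sum_(m < N) e m.
Proof.
move=> e0 kN; rewrite -(big_mkord xpredT (fun j => e ((k - j) + (j - k))%N)).
rewrite (@big_cat_nat _ _ _ k)//=; last exact: ltnW.
rewrite mulr_natl mulr2n; apply: lerD.
  rewrite big_mkord (reindex_inj rev_ord_inj)/=.
  apply: (@le_trans _ _ (\sum_(0 <= m < k.+1) e m)).
    rewrite big_nat_recl// -[leLHS]add0r lerD// big_mkord; apply: ler_sum => i _.
    by rewrite subKn// (_ : (k - i.+1 - k)%N = 0%N) ?addn0//; lia.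
  rewrite -(big_mkord xpredT e) [leRHS](@big_cat_nat _ _ _ k.+1)//= lerDl.
  exact: sumr_ge0.
rewrite -{1}[k]add0n big_addn big_mkord.
apply: (@le_trans _ _ (\sum_(0 <= m < N - k) e m)).
  rewrite big_mkord; apply: ler_sum => i _.
  by rewrite (_ : (k - (i + k) + (i + k - k))%N = i)//; lia.
rewrite -(big_mkord xpredT e) [leRHS](@big_cat_nat _ _ _ (N - k))//= ?leq_subr// lerDl.
exact: sumr_ge0.
Qed.

Lemma sum_le_cst (R : realType) (I : finType) (F : I -> R) c :
  (forall i, F i <= c) -> \sum_i F i <= #|I|%:R * c.
Proof. by move=> Fc; rewrite mulr_natl -sumr_const; exact: ler_sum. Qed.

Lemma prod_le_cst (R : realType) (I : finType) (F : I -> R) c :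
  (forall i, 0 <= F i <= c) -> \prod_i F i <= c ^+ #|I|.
Proof. by move=> Fc; rewrite -prodr_const; exact: ler_prod. Qed.

Section counting.
Context (R : realType) (d : nat) (d0 : measure_display).
Context (Omega : measurableType d0) (P : probability Omega R).
Context (Z : Omega -> 'cV[R]_d).
Hypothesis mZ : measurable_fun setT Z.
Context (alpha K b : R).
Hypotheses (dpos : (0 < d)%N) (alpha0 : 0 < alpha) (K0 : 0 < K) (b0 : 0 < b).
Hypothesis hcf : forall (xi : 'cV[R]_d) y,
  `|\int[P]_w cos (dotp xi (Z w) - y)| <= K * expR (- (b * `|xi| `^ alpha)).

Let lat N (f : {ffun 'I_d -> 'I_N}) : 'cV[R]_d := \col_i (f i)%:R.

Let e m := expR (- (b / d%:R * m%:R `^ alpha)).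

(** The power of the sup norm is at least the average of the powers of the coordinates, hence
    [b / d] in [e]. The product form lets the sum over the lattice factor into one-dimensional
    sums. *)
Lemma lat_decay N (f g : {ffun 'I_d -> 'I_N}) :
  expR (- (b * `|lat f - lat g| `^ alpha)) <=
  \prod_i e ((f i - g i) + (g i - f i))%N.
Proof.
have D0 : 0 < d%:R :> R by rewrite ltr0n.
rewrite /e -expR_sum ler_expR sumrN lerN2 -mulr_sumr -mulrA ler_wpM2l ?(ltW b0)//.
rewrite ler_pdivrMl//; have := @sum_le_cst R 'I_d; rewrite card_ord; apply => i.
rewrite ge0_ler_powR ?nnegrE ?(ltW alpha0)//.
apply: le_trans (cV_norm_coord _ i); rewrite !mxE.
have [fg|gf] := leqP (f i) (g i).
  by rewrite (eqP fg) add0n natrB// distrC ler_norm.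
by rewrite (eqP (ltnW gf)) addn0 natrB ?(ltnW gf)// ler_norm.
Qed.

Lemma lat_sum N : \sum_(f : {ffun 'I_d -> 'I_N}) \sum_(g : {ffun 'I_d -> 'I_N})
    expR (- (b * `|lat f - lat g| `^ alpha)) <=
  (N ^ d)%:R * (2 * \sum_(m < N) e m) ^+ d.
Proof.
rewrite (_ : (N ^ d)%N = #|{ffun 'I_d -> 'I_N}|); last by rewrite card_ffun !card_ord.
apply: sum_le_cst => f.
apply: (@le_trans _ _ (\sum_(g : {ffun 'I_d -> 'I_N}) \prod_i e ((f i - g i) + (g i - f i))%N)).
  by apply: ler_sum => g _; exact: lat_decay.
rewrite -(bigA_distr_bigA (fun (i : 'I_d) (j : 'I_N) => e ((f i - j) + (j - f i))%N)).
have := @prod_le_cst R 'I_d; rewrite card_ord; apply => i.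
rewrite sumr_ge0/=; last by move=> j _; exact: expR_ge0.
by apply: sum_dist_le => // m; exact: expR_ge0.
Qed.

Lemma prob_box_le N (y : 'cV[R]_d) : (0 < N)%N ->
  fine (P (Z @^-1` box y (d%:R * N%:R)^-1)) * N%:R ^+ d <=
  4 * K * (2 * \sum_(m < N) e m) ^+ d.
Proof.
move=> N0; have D0 : 0 < d%:R :> R by rewrite ltr0n.
have NR0 : 0 < N%:R :> R by rewrite ltr0n.
pose th (f : {ffun 'I_d -> 'I_N}) w := dotp (lat f) (Z w - y).
(* Squared modulus of the exponential sum over the lattice cube; by [FE] it is a double sum of
   cosines at differences of lattice points, to which [hcf] applies. *)
pose F w := (\sum_f cos (th f w)) ^+ 2 + (\sum_f sin (th f w)) ^+ 2.
have mth xi c : measurable_fun setT (fun w => dotp xi (Z w) - c).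
  apply: measurable_funB => //; apply: measurableT_comp => //; exact: measurable_dotp.
have FE w : F w =
    \sum_(f : {ffun 'I_d -> 'I_N}) \sum_(g : {ffun 'I_d -> 'I_N}) cos (dotp (lat f - lat g) (Z w) - dotp (lat f - lat g) y).
  rewrite /F !expr2 !mulr_suml -big_split/=; apply: eq_bigr => f _.
  rewrite !mulr_sumr -big_split/=; apply: eq_bigr => g _.
  by rewrite -cosB /th -dotpBl -dotpBr.
have bcos (f g : {ffun 'I_d -> 'I_N}) : bmeas (fun w => cos (dotp (lat f - lat g) (Z w) - dotp (lat f - lat g) y)).
  exact: bmeas_cos.
have bF : bmeas F.
  rewrite (funext FE); apply: bmeas_sum => f; exact: bmeas_sum.
have intF : \int[P]_w F w <= K * ((N ^ d)%:R * (2 * \sum_(m < N) e m) ^+ d).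
  under eq_Rintegral do rewrite FE.
  rewrite bint_sum; last by move=> f; exact: bmeas_sum.
  apply: le_trans (ler_wpM2l (ltW K0) (lat_sum N)); rewrite mulr_sumr.
  apply: ler_sum => f _; rewrite bint_sum// mulr_sumr; apply: ler_sum => g _.
  exact: le_trans (ler_norm _) (hcf _ _).
have mB : measurable (Z @^-1` box y (d%:R * N%:R)^-1).
  by rewrite -[X in measurable X]setTI; apply: mZ => //; exact: measurable_box.
have FB w : ((N ^ d)%:R / 2) ^+ 2 * \1_(Z @^-1` box y (d%:R * N%:R)^-1) w <= F w.
  rewrite indicE; case: (boolP (w \in _)) => [/set_mem/= wB|_]; last first.
    by rewrite mulr0 addr_ge0// sqr_ge0.
  (* On the box every phase is at most [d * N / (d N) = 1] in absolute value, so each cosine is at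
     least 1/2. *)
  have hcos : (N ^ d)%:R / 2 <= \sum_f cos (th f w).
    rewrite (_ : (N ^ d)%N = #|{ffun 'I_d -> 'I_N}|); last by rewrite card_ffun !card_ord.
    rewrite mulr_natl -sumr_const; apply: ler_sum => f _; apply: cos_ge_half.
    apply: le_trans (dotp_norm _ _) _.
    apply: (@le_trans _ _ (d%:R * (N%:R * (d%:R * N%:R)^-1))); last first.
      by rewrite mulrA divff// mulf_neq0// gt_eqF.
    rewrite ler_wpM2l//; apply: ler_pM => //.
      by apply: cV_norm_le => // i; rewrite mxE normr_nat ler_nat ltnW.
    by apply: box_norm => //; rewrite invr_ge0 mulr_ge0.
  rewrite mulr1 /F -[leLHS]addr0 lerD ?sqr_ge0// lerXn2r ?nnegrE ?divr_ge0//.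
  by apply: le_trans hcos; rewrite divr_ge0.
have := bint_le P (bmeasZ _ (bmeas_indic R mB)) bF FB.
rewrite bintZ; last exact: bmeas_indic.
rewrite bint_indic// => h; have {intF}h := le_trans h intF.
have n0 : 0 < (N ^ d)%:R :> R by rewrite ltr0n expn_gt0 N0.
rewrite -natrX; move: n0 h; move: (N ^ d)%:R (fine _) ((2 * _) ^+ d) => n p E n0 h.
rewrite -(ler_pM2l n0).
have -> : n * (p * n) = 4 * ((n / 2) ^+ 2 * p) by field.
have -> : n * (4 * K * E) = 4 * (K * (n * E)) by ring.
by rewrite ler_pM2l.
Qed.

End counting.

(** * From cubes to Borel sets *)

Section dyadic.
Context (R : realType) (d : nat) (D : nat).
Hypothesis D0 : (0 < D)%N.
Implicit Types (x y : 'cV[R]_d) (k : 'cV[int]_d).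

(** Cells per unit length at level [n]. With [D = d] the cells have the side [1 / (d N)] of
    [prob_box_le] for [N = 2 ^ n]. *)
Definition mesh n : R := (D * 2 ^ n)%:R.

Lemma mesh_gt0 n : 0 < mesh n.
Proof. by rewrite ltr0n muln_gt0 D0 expn_gt0. Qed.

Definition grid n x : 'cV[int]_d := \col_i Num.floor (mesh n * x i 0).

Definition corner n k : 'cV[R]_d := \col_i ((k i 0)%:~R / mesh n).

Lemma gridP n k : grid n @^-1` [set k] = box (corner n k) (mesh n)^-1.
Proof.
have m0 := mesh_gt0 n.
have fE x i : (Num.floor (mesh n * x i 0) == k i 0) =
    (corner n k i 0 <= x i 0 < corner n k i 0 + (mesh n)^-1).
  rewrite floor_eq /corner mxE ler_pdivrMr// mulrC -[X in _ && _ = _ && (_ < _ + X)]mul1r -mulrDl.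
  by rewrite ltr_pdivlMr// intrD mulrC.
apply/seteqP; split => x /= h.
  by move=> i; rewrite -fE; apply/eqP; rewrite -h mxE.
by apply/colP => i; rewrite mxE; apply/eqP; rewrite fE.
Qed.

(** The coarse floor is determined by the fine one: [j <= floor z] if and only if
    [c j <= floor (c z)] for a positive integer [c]. *)
Lemma grid_coarse n m x y : (n <= m)%N -> grid m x = grid m y -> grid n x = grid n y.
Proof.
move=> nm /colP e; apply/colP => i; have := e i; rewrite !mxE => {}e.
pose c : nat := (2 ^ (m - n))%N; have c0 : 0 < c%:R :> R by rewrite ltr0n expn_gt0.
have mE z : mesh m * z = c%:R * (mesh n * z).
  by rewrite mulrA -natrM /mesh mulnCA -expnD subnK.
have H (j : int) (z : R) : (j <= Num.floor (mesh n * z)) = (c%:Z * j <= Num.floor (mesh m * z)).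
  by rewrite !floor_ge_int mE intrM ler_pM2l.
by apply/eqP; rewrite eq_le H -e -H lexx H e -H lexx.
Qed.

Definition dyadic n (S : set 'cV[int]_d) : set 'cV[R]_d := grid n @^-1` S.

Lemma measurable_dyadic n S : measurable (dyadic n S).
Proof.
have -> : dyadic n S = \bigcup_(k : 'cV[int]_d) (if `[< S k >] then grid n @^-1` [set k] else set0).
  apply/seteqP; split => [x Sx|x [k _]].
    by exists (grid n x) => //; case: asboolP.
  by case: asboolP => // Sk xk; rewrite /dyadic/preimage/= xk.
apply: countable_bigcupT_measurable; first exact: countableP.
by move=> k; case: asboolP => // _; rewrite gridP; exact: measurable_box.
Qed.

Lemma dyadic_refine n m S : (n <= m)%N -> exists S', dyadic n S = dyadic m S'.
Proof.
move=> nm; exists [set k | exists2 x, grid m x = k & S (grid n x)].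
apply/seteqP; split => x /=; first by move=> Sx; exists x.
by move=> [y yx]; rewrite (grid_coarse nm yx).
Qed.

Lemma dyadicU n1 S1 n2 S2 : exists n S, dyadic n1 S1 `|` dyadic n2 S2 = dyadic n S.
Proof.
have [S1' ->] := dyadic_refine S1 (leq_maxl n1 n2).
have [S2' ->] := dyadic_refine S2 (leq_maxr n1 n2).
by exists (maxn n1 n2), (S1' `|` S2').
Qed.

Lemma dyadicI n1 S1 n2 S2 : exists n S, dyadic n1 S1 `&` dyadic n2 S2 = dyadic n S.
Proof.
have [S1' ->] := dyadic_refine S1 (leq_maxl n1 n2).
have [S2' ->] := dyadic_refine S2 (leq_maxr n1 n2).
by exists (maxn n1 n2), (S1' `&` S2').
Qed.

Lemma dyadic_bigcup (n_ : nat -> nat) S_ N :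
  exists n S, \bigcup_(i < N) dyadic (n_ i) (S_ i) = dyadic n S.
Proof.
rewrite bigcup_mkord; elim: N => [|N [n [S h]]].
  by exists 0%N, set0; rewrite big_ord0 /dyadic preimage_set0.
by rewrite big_ord_recr/= h; exact: dyadicU.
Qed.

Lemma open_dyadic (U : set 'cV[R]_d) : open U ->
  U = \bigcup_n dyadic n [set k | grid n @^-1` [set k] `<=` U].
Proof.
move=> Uo; apply/seteqP; split => [x Ux|x [n _]]; last by apply.
have /nbhs_ballP[e /= e0 eU] : nbhs x U by exact: open_nbhs_nbhs.
exists (Num.bound e^-1) => // y /= yx; apply: eU; split => // i j; rewrite ord1 /ball/=.
pose n := Num.bound e^-1; have m0 := mesh_gt0 n.
have : (grid n @^-1` [set grid n x]) x by [].
have : (grid n @^-1` [set grid n x]) y by [].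
rewrite gridP => hy hx.
have /andP[y1 y2] := hy i; have /andP[x1 x2] := hx i.
have me : (mesh n)^-1 < e.
  rewrite -[ltRHS]invrK ltf_pV2 ?posrE ?invr_gt0//.
  apply: (@lt_trans _ _ n%:R); first by rewrite archi_boundP// invr_ge0 ltW.
  rewrite ltr_nat (leq_trans (ltn_expl n (ltnSn 1)))// leq_pmull//.
rewrite ltr_norml; apply/andP; split; lra.
Qed.

Lemma open_dyadic_mono (U : set 'cV[R]_d) n m : (n <= m)%N ->
  dyadic n [set k | grid n @^-1` [set k] `<=` U] `<=`
  dyadic m [set k | grid m @^-1` [set k] `<=` U].
Proof. by move=> nm x /= h y /= yx; apply: h => /=; exact: grid_coarse yx. Qed.

Section approx.
Context (m : {measure set 'cV[R]_d -> \bar R}).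
Hypothesis mfin : (m setT < +oo)%E.

Let symd (A B : set 'cV[R]_d) := (A `\` B) `|` (B `\` A).

Let approximable (B : set 'cV[R]_d) := measurable B /\
  forall e : R, 0 < e -> exists n S, (m (symd B (dyadic n S)) <= e%:E)%E.

Let msymd A B : measurable A -> measurable B -> measurable (symd A B).
Proof. by move=> mA mB; apply: measurableU; exact: measurableD. Qed.

Let m_fin A : measurable A -> (m A < +oo)%E.
Proof. by move=> mA; apply: le_lt_trans mfin; apply: le_measure => //; rewrite inE. Qed.

(** Continuity from above along the remainders, which decrease to the empty set and have finite
    measure. *)
Lemma approx_nondecreasing (B : nat -> set 'cV[R]_d) e : 0 < e ->
  (forall i, measurable (B i)) -> {homo B : i j / (i <= j)%N >-> i `<=` j} ->
  exists N, (m ((\bigcup_i B i) `\` B N) <= e%:E)%E.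
Proof.
move=> e0 mB homoB.
have mU : measurable (\bigcup_i B i) by exact: bigcup_measurable.
have mC i : measurable ((\bigcup_i B i) `\` B i) by exact: measurableD.
have C0 : \bigcap_i ((\bigcup_i B i) `\` B i) = set0.
  apply/seteqP; split => // x h; have [[j _ Bj] _] := h 0%N I.
  by have [_] := h j I.
have cv : m \o (fun i => (\bigcup_i B i) `\` B i) @ \oo --> m (\bigcap_i ((\bigcup_i B i) `\` B i)).
  apply: nonincreasing_cvg_mu => //; first exact: m_fin.
    by rewrite C0.
  by move=> i j ij; apply/subsetPset => x [Ux nBj]; split => // Bi; apply: nBj; exact: homoB Bi.
rewrite C0 measure0 in cv.
have : \forall i \near \oo, ((m \o (fun i => (\bigcup_i B i) `\` B i)) i < e%:E)%E.
  by apply: (cv [set z | (z < e%:E)%E]); apply: open_nbhs_nbhs; split; [exact: open_ereal_lt_ereal|rewrite /= lte_fin].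
by move=> [N _ HN]; exists N; apply/ltW/(HN N)/leqnn.
Qed.

(** The sets approximable in measure by dyadic sets form a sigma-algebra, and it contains the open
    sets because these are increasing unions of dyadic sets. *)
Lemma approx_measurable (B : set 'cV[R]_d) (e : R) : measurable B -> 0 < e ->
  exists n S, (m (symd B (dyadic n S)) <= e%:E)%E.
Proof.
suff sub : measurable `<=` approximable by move=> /sub[_]; exact.
apply: smallest_sub; last first.
  move=> U Uo; split; first exact: sub_sigma_algebra.
  move=> {}e e0.
  have [N hN] := approx_nondecreasing e0 (fun i => measurable_dyadic i _) (@open_dyadic_mono U).
  rewrite -(open_dyadic Uo) in hN.
  exists N, [set k | grid N @^-1` [set k] `<=` U]; apply: le_trans hN.
  apply: le_measure; rewrite ?inE.
  - by apply: msymd; [exact: sub_sigma_algebra|exact: measurable_dyadic].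
  - by apply: measurableD; [exact: sub_sigma_algebra|exact: measurable_dyadic].
  - by move=> x [//|[h nU]]; exfalso; apply: nU; exact: h.
split.
- split=> // {}e e0; exists 0%N, set0.
  by rewrite /symd /dyadic preimage_set0 setD0 setU0 measure0 lee_fin ltW.
- move=> A [mA hA]; split; first by rewrite setTD; exact: measurableC.
  move=> {}e /hA[n [S h]]; exists n, (~` S); apply: le_trans h.
  rewrite le_eqVlt; apply/orP; left; apply/eqP; congr (m _).
  rewrite /symd /dyadic preimage_setC setTD setDE setCK [X in _ `|` X]setDE setCK.
  by rewrite setUC setIC [X in _ `|` X]setIC -!setDE setUC; congr (_ `|` _).
- move=> A hA; have mA i : measurable (A i) by case: (hA i).
  split; first exact: bigcup_measurable.
  move=> {}e e0.
  have e20 : 0 < e / 2 by rewrite divr_gt0.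
  (* Half of [e] pays for cutting the union at [N], the other half is shared among the
     approximations of the remaining sets. *)
  pose V N := \bigcup_(i < N) A i.
  have VE : \bigcup_i A i = \bigcup_N V N.
    apply/seteqP; split => x; first by move=> [i _ Ai]; exists i.+1 => //; exists i => /=.
    by move=> [N _ [i _ Ai]]; exists i.
  have mV N : measurable (V N) by exact: bigcup_measurable.
  have [N hN] : exists N, (m ((\bigcup_i A i) `\` V N) <= (e / 2)%:E)%E.
    rewrite VE; apply: approx_nondecreasing => // i j ij x [l /= li Al].
    by exists l => //=; exact: leq_trans ij.
  have eN0 : 0 < e / 2 / N.+1%:R by rewrite divr_gt0.
  have /choice[nS hnS] i : exists nS : nat * set 'cV[int]_d,
      (m (symd (A i) (dyadic nS.1 nS.2)) <= (e / 2 / N.+1%:R)%:E)%E.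
    by have [_ /(_ _ eN0)[n [S h]]] := hA i; exists (n, S).
  have [n [S E]] := dyadic_bigcup (fun i => (nS i).1) (fun i => (nS i).2) N.
  exists n, S; rewrite -E.
  pose C i := symd (A i) (dyadic (nS i).1 (nS i).2).
  have mC i : measurable (C i) by apply: msymd => //; exact: measurable_dyadic.
  have mUC : measurable (\big[setU/set0]_(i < N) C i) by exact: bigsetU_measurable.
  have mAB : measurable ((\bigcup_i A i) `\` V N).
    by apply: measurableD => //; exact: bigcup_measurable.
  apply: (@le_trans _ _ (m (((\bigcup_i A i) `\` V N) `|` \big[setU/set0]_(i < N) C i))).
    apply: le_measure; rewrite ?inE.
    + apply: msymd; first exact: bigcup_measurable.
      by rewrite E; exact: measurable_dyadic.
    + exact: measurableU.
    + rewrite -bigcup_mkord => x [[[i _ Ai] nE]|[[i /= iN Ei] nA]].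
        have [[j /= jN Aj]|nV] := pselect (V N x); last by left; split => //; exists i.
        right; exists j => //; left; split => // Ej; apply: nE; exists j => //.
      by right; exists i => //; right; split => // Ai; apply: nA; exists i.
  apply: (le_trans (measureU2 _ _ _)) => //.
  rewrite [e]splitr EFinD; apply: leeD => //.
  apply: (le_trans (Boole_inequality _ _)) => //.
  apply: (@le_trans _ _ (\sum_(i < N) (e / 2 / N.+1%:R)%:E)%E).
    by apply: lee_sum => i _; exact: hnS.
  rewrite sumEFin lee_fin sumr_const card_ord -[leLHS]mulr_natr -[leRHS]mulr1 -[leLHS]mulrA.
  by rewrite ler_wpM2l ?(ltW e20)// mulrC ler_pdivrMr// mul1r ler_nat.
Qed.

End approx.

Lemma dyadic_le (mu nu : {measure set 'cV[R]_d -> \bar R}) (C : R) : 0 <= C ->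
  (forall n k, (mu (grid n @^-1` [set k]) <= C%:E * nu (grid n @^-1` [set k]))%E) ->
  forall n S, (mu (dyadic n S) <= C%:E * nu (dyadic n S))%E.
Proof.
move=> C0 h n S.
(* Enumerating the cells by [pickle] makes each [F j] one cell or empty, so countable additivity
   applies. *)
pose F j := dyadic n [set k | pickle k = j /\ S k].
have mF j : measurable (F j) by exact: measurable_dyadic.
have tF : trivIset setT F.
  apply/trivIsetP => i j _ _ ij; apply/seteqP; split => // x [[xi _] [xj _]].
  by move: ij; rewrite -xi -xj eqxx.
have -> : dyadic n S = \bigcup_j F j.
  by apply/seteqP; split => [x Sx|x [j _ []]//]; exists (pickle (grid n x)).
rewrite !measure_bigcup// -nneseriesZl//; apply: lee_nneseries => // j _.
have [[k [kj Sk]]|nk] := pselect (exists k, pickle k = j /\ S k).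
  rewrite (_ : F j = grid n @^-1` [set k])//; apply/seteqP; split => x /=.
    by move=> [xj _]; apply: (pcan_inj pickleK); rewrite xj.
  by rewrite /F /dyadic/preimage/= => ->.
rewrite (_ : F j = set0) ?measure0 ?mule0//.
by apply/seteqP; split => // x [xj Sx]; apply: nk; exists (grid n x).
Qed.

(** The cube [[-j, j)^d] as a union of cells of level 0; windows have finite Lebesgue measure and
    exhaust the space. *)
Definition window j : set 'cV[R]_d :=
  dyadic 0 [set k | forall i, - (j * D)%:Z <= k i 0 < (j * D)%:Z].

Lemma windowE j : window j = box (const_mx (- j%:R)) (j%:R + j%:R).
Proof.
have DR0 : 0 < D%:R :> R by rewrite ltr0n.
have jE x i : (- (j * D)%:Z <= grid 0 x i 0 < (j * D)%:Z) = (- j%:R <= x i 0 < j%:R).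
  rewrite mxE /mesh expn0 muln1 floor_ge_int floor_lt_int mulrNz -!pmulrn natrM.
  by rewrite mulrC -mulrN ler_pM2l// ltr_pM2l.
have aE : - j%:R + (j%:R + j%:R) = j%:R :> R by ring.
by apply/seteqP; split => x h i; have := h i; rewrite [const_mx _ i 0]mxE aE jE.
Qed.

Lemma dyadic_dominated (mu nu : {measure set 'cV[R]_d -> \bar R}) (C : R) : 0 <= C ->
  (mu setT < +oo)%E -> (forall j, nu (window j) < +oo)%E ->
  (forall n k, (mu (grid n @^-1` [set k]) <= C%:E * nu (grid n @^-1` [set k]))%E) ->
  forall B, measurable B -> (mu B <= C%:E * nu B)%E.
Proof.
move=> C0 mufin nufin h B mB.
have mW j : measurable (window j) by exact: measurable_dyadic.
have loc j : (mu (B `&` window j) <= C%:E * nu (B `&` window j))%E.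
  apply/lee_addgt0Pr => e e0.
  (* A single finite measure controls the approximation error for [mu] and for [nu] on the window at
     once. *)
  pose m := measure_add mu (mrestr nu (mW j)).
  have mE A : m A = (mu A + nu (A `&` window j))%E by rewrite /m measure_addE.
  have mfin : (m setT < +oo)%E by rewrite mE setTI lte_add_pinfty.
  (* The error enters once through [mu] and once, multiplied by [C], through [nu]. *)
  pose e' := e / (1 + C); have C1 : 0 < 1 + C by rewrite ltr_wpDr.
  have e'0 : 0 < e' by rewrite divr_gt0.
  have [n [S]] := approx_measurable mfin (measurableI _ _ mB (mW j)) e'0.
  have [n' [S' EW]] := dyadicI n S 0 [set k | forall i, - (j * D)%:Z <= k i 0 < (j * D)%:Z].
  rewrite -/(window j) in EW; set E := dyadic n S in EW *.
  set Y := _ `|` _ => mY.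
  have mEm : measurable E by exact: measurable_dyadic.
  have mBW : measurable (B `&` window j) by exact: measurableI.
  have mYm : measurable Y by apply: measurableU; exact: measurableD.
  have mY' : (mu Y + nu (Y `&` window j) <= e'%:E)%E by rewrite -mE.
  have muY : (mu Y <= e'%:E)%E by apply: le_trans mY'; rewrite leeDl.
  have nuY : (nu (Y `&` window j) <= e'%:E)%E by apply: le_trans mY'; rewrite leeDr.
  have s1 : (mu (B `&` window j) <= mu (E `&` window j) + mu Y)%E.
    have mEW : measurable (E `&` window j) by exact: measurableI.
    apply: (le_trans _ (measureU2 mu mEW mYm)).
    apply: le_measure; rewrite ?inE//; first exact: measurableU.
    move=> x xBW; have [xE|nE] := pselect (E x); last by right; left.
    by left; split => //; case: xBW.
  have s2 : (nu (E `&` window j) <= nu (B `&` window j) + nu (Y `&` window j))%E.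
    have mYW : measurable (Y `&` window j) by exact: measurableI.
    apply: (le_trans _ (measureU2 nu mBW mYW)).
    apply: le_measure; rewrite ?inE//; first exact: measurableI.
      exact: measurableU.
    move=> x [xE xW]; have [xB|nB] := pselect (B x); first by left.
    by right; split => //; right; split => // -[].
  apply: (le_trans s1); apply: (@le_trans _ _ (C%:E * (nu (B `&` window j) + e'%:E) + e'%:E)%E).
    apply: leeD => //; rewrite EW; apply: (le_trans (dyadic_le C0 h _ _)); rewrite -EW.
    apply: lee_wpmul2l; first by rewrite lee_fin.
    by apply: (le_trans s2); apply: leeD.
  rewrite ge0_muleDr ?lee_fin ?(ltW e'0)//.
  rewrite -addeA leeD2l// -EFinM -EFinD lee_fin.
  by rewrite -{2}[e'](mul1r) -mulrDl addrC /e' mulrC divfK ?gt_eqF.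
have homoW i j : (i <= j)%N -> window i `<=` window j.
  move=> ij x /= hx l; have /andP[h1 h2] := hx l; apply/andP; split.
    by apply: le_trans h1; rewrite lerN2 lez_nat leq_mul2r ij orbT.
  by apply: lt_le_trans h2 _; rewrite lez_nat leq_mul2r ij orbT.
have WT : \bigcup_j window j = setT.
  apply/seteqP; split => // x _.
  exists (Num.bound `|x|) => //; rewrite windowE => i; rewrite mxE.
  have -> : - (Num.bound `|x|)%:R + ((Num.bound `|x|)%:R + (Num.bound `|x|)%:R) =
    (Num.bound `|x|)%:R :> R by ring.
  have xi : `|x i 0| < (Num.bound `|x|)%:R.
    by apply: le_lt_trans (cV_norm_coord x i) _; rewrite archi_boundP.
  by move: xi; rewrite ltr_norml => /andP[/ltW -> ->].
have cv : mu \o (fun j => B `&` window j) @ \oo --> mu B.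
  rewrite -[X in _ --> mu X](_ : \bigcup_j (B `&` window j) = B); last by rewrite -setI_bigcupr WT setIT.
  apply: nondecreasing_cvg_mu.
  - by move=> i; exact: measurableI.
  - by apply: bigcup_measurable => i _; exact: measurableI.
  - by move=> i j ij; apply/subsetPset; apply: setIS; exact: homoW.
apply: (cvge_to_le cv); near=> j => /=.
apply: (le_trans (loc j)); apply: lee_wpmul2l; first by rewrite lee_fin.
by apply: le_measure; rewrite ?inE//; exact: measurableI.
Unshelve. all: by end_near. Qed.

End dyadic.

(** * The semigroup estimate *)

(** With [p] the integer part of [t] plus one, the last period [tau = t / p] is at most 1 and still
    comparable to [min 1 t]. *)
Lemma split_time (R : realType) (t : R) : 0 < t ->
  exists p : nat, exists tau, [/\ (0 < p)%N, t = p%:R * tau, 0 < tau, tau <= 1 &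
    Num.min 1 t / 2 <= tau].
Proof.
move=> t0; have /andP[t1 t2] := truncn_itv (ltW t0).
pose p := (Num.trunc t).+1; have p0 : 0 < p%:R :> R by rewrite ltr0n.
exists p, (t / p%:R); split => //; first by rewrite mulrC divfK// gt_eqF.
- exact: divr_gt0.
- by rewrite ler_pdivrMr// mul1r ltW.
- rewrite ler_pdivlMr//.
  have pt : p%:R <= t + 1 by rewrite -natr1 lerD2r.
  by rewrite /Num.min; case: ltP => ?; nra.
Qed.

Section smoothing.
Context (R : realType) (d : nat) (d0 : measure_display).
Context (Omega : measurableType d0) (P : probability Omega R).
Context (Z : Omega -> 'cV[R]_d).
Hypothesis mZ : measurable_fun setT Z.
Hypothesis dpos : (0 < d)%N.

Let law : {measure set 'cV[R]_d -> \bar R} :=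
  @measure_function_pushforward__canonical__measure_function_Measure _ _ _ _ _ P _ mZ.

(** Taking the absolute value inside leaves integrals of a nonnegative function, which are monotone
    in the measure, here the law of [Z] against [C] times Lebesgue measure. *)
Lemma expectation_le_norm1 (C : R) : 0 <= C ->
  (forall B, measurable B -> (P (Z @^-1` B) <= C%:E * @lebesgue_measure_cV R d B)%E) ->
  forall f : 'cV[R]_d -> R, measurable_fun setT f ->
  (`|'E_P[fun w => f (Z w)]| <= C%:E * 'N[@lebesgue_measure_cV R d]_1[EFin \o f])%E.
Proof.
move=> C0 hC f mf; rewrite Lnorm1 unlock.
have mfa : measurable_fun setT (fun x => `|(f x)%:E|%E).
  by apply: measurableT_comp => //; apply: measurableT_comp.
apply: (@le_trans _ _ (\int[P]_w `|(f (Z w))%:E|)%E).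
  apply: le_abse_integral => //; apply: measurableT_comp => //.
  exact: measurableT_comp.
have -> : (\int[P]_w `|(f (Z w))%:E| = \int[law]_x `|(f x)%:E|)%E.
  by rewrite (ge0_integral_pushforward mZ P measurableT mfa).
pose Cn : {nonneg R} := NngNum C0.
apply: (@le_trans _ _ (\int[mscale Cn (@lebesgue_measure_cV R d)]_x `|(f x)%:E|)%E).
  apply: ge0_le_measure_integral => // S mS; exact: hC.
by rewrite ge0_integral_mscale.
Qed.

Lemma law_dominated (al K b K2 : R) : 0 < al -> 0 < K -> 0 < b -> 0 <= K2 ->
  (forall (xi : 'cV[R]_d) y,
    `|\int[P]_w cos (dotp xi (Z w) - y)| <= K * expR (- (b * `|xi| `^ al))) ->
  (forall n, \sum_(i < n) expR (- (b / d%:R * i%:R `^ al)) <= K2) ->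
  forall B, measurable B ->
  (P (Z @^-1` B) <= (4 * K * (2 * K2) ^+ d * d%:R ^+ d)%:E * @lebesgue_measure_cV R d B)%E.
Proof.
move=> al0 K0 b0 K20 hcf hK2 B mB.
have D0 : 0 < d%:R :> R by rewrite ltr0n.
have C0 : 0 <= 4 * K * (2 * K2) ^+ d * d%:R ^+ d.
  by rewrite !mulr_ge0 ?exprn_ge0 ?mulr_ge0// ltW.
apply: (dyadic_dominated dpos (mu := law) (nu := @lebesgue_measure_cV R d) C0) => //.
- rewrite /law/= /pushforward preimage_setT.
  by have := @probability_setT _ _ _ P => /= ->; rewrite ltry.
- move=> j; rewrite windowE//.
  have j0 : 0 <= j%:R + j%:R :> R by exact: addr_ge0.
  by rewrite [X in (X < _)%E](lebesgue_measure_box (const_mx (- j%:R)) j0) ltry.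
- move=> n k; rewrite gridP//; set s := (mesh R d n)^-1.
  have s0 : 0 < s by rewrite invr_gt0 mesh_gt0.
  rewrite [X in (_ <= _ * X)%E](lebesgue_measure_box (corner R d n k) (ltW s0)) -EFinM.
  have N0 : (0 < 2 ^ n)%N by rewrite expn_gt0.
  have NR0 : 0 < (2 ^ n)%:R :> R by rewrite ltr0n.
  have := prob_box_le mZ dpos al0 K0 b0 hcf (corner R d n k) N0.
  have -> : (d%:R * (2 ^ n)%:R)^-1 = s :> R by rewrite -natrM.
  move=> h.
  rewrite -[leLHS]fineK; last by apply: fin_num_measure; rewrite -[X in measurable X]setTI; apply: mZ => //; exact: measurable_box.
  (* The factor [d ^ d] in the constant compensates for cells of side [1 / (d 2^n)], whereas
     [prob_box_le] is normalised by [2^n]. *)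
  have sE : s ^+ d = (d%:R ^+ d)^-1 * ((2 ^ n)%:R ^+ d)^-1.
    by rewrite /s /mesh natrM invfM exprMn !exprVn.
  rewrite lee_fin sE.
  have -> : 4 * K * (2 * K2) ^+ d * d%:R ^+ d * ((d%:R ^+ d)^-1 * ((2 ^ n)%:R ^+ d)^-1) =
      4 * K * (2 * K2) ^+ d / (2 ^ n)%:R ^+ d.
    by rewrite mulrA mulfK// expf_neq0// gt_eqF.
  rewrite ler_pdivlMr ?exprn_gt0//; apply: (le_trans h).
  rewrite ler_wpM2l// ?mulr_ge0 ?(ltW K0)// lerXn2r ?nnegrE ?mulr_ge0//.
    by apply: sumr_ge0 => i _; exact: expR_ge0.
  by rewrite ler_wpM2l.
Qed.

End smoothing.

Theorem theorem4p2 (R : realType) (d : nat) (hd : (0 < d)%N)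
  (d0 : measure_display) (Omega : measurableType d0) (P : probability Omega R)
  (A : 'M[R]_d)
  (b : 'cV[R]_d) (Q : 'M[R]_d) (nu : {measure set 'cV[R]_d -> \bar R})
  (L : R -> Omega -> 'cV[R]_d) (X : 'cV[R]_d -> R -> Omega -> 'cV[R]_d)
  (alpha c r : R)
  (hQ : nonneg_definite Q) (hnu : levy_measure nu)
  (hL : levy_process P L) (hgen : generated_by P L (levy_operator b Q nu))
  (hX : forall x, ou_solution P A L x (X x))
  (halpha : 0 < alpha < 2) (hc : 0 < c) (hr : 0 < r)
  (hlower : forall B : set 'cV[R]_d, measurable B ->
    (\int[@lebesgue_measure_cV R d]_(z in B)
       (c / enorm z `^ (alpha + d%:R) * (enorm z < r)%R%:R)%:E <= nu B)%E) :
  exists c' : R, 0 < c' /\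
    forall t : R, 0 < t ->
      (norm_1_oo (ou_semigroup P X t) <=
       (c' / (Num.min 1 t) `^ (d%:R / alpha))%:E)%E.
Proof.
have /andP[alpha0 _] := halpha.
have D0 : 0 < d%:R :> R by rewrite ltr0n.
have [c1 c10 [c2 c20 decay]] := cf2_levy_decay hL hgen hQ hnu alpha0 hc hr hd hlower.
pose k1 := c1 * expR (- mx_bound A) `^ alpha.
have k10 : 0 < k1 by rewrite mulr_gt0// powR_gt0// expR_gt0.
have [K2 K20 hK2] := sum_expR_powR_le alpha0.
(* The exponent is halved because [ou_cos_sqr_le] bounds the square. *)
pose K := expR (c2 / 2); have K0 : 0 < K by exact: expR_gt0.
pose K3 := K2 * (1 + (k1 / 4 / d%:R) `^ (- alpha^-1)).
have K30 : 0 < K3 by rewrite mulr_gt0// ltr_wpDr// powR_ge0.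
exists (4 * K * (2 * K3) ^+ d * d%:R ^+ d); split.
  by rewrite !mulr_gt0// ?exprn_gt0// mulr_gt0.
move=> t t0; set m := Num.min 1 t.
have m0 : 0 < m by rewrite lt_min ltr01.
have m1 : m <= 1 by rewrite ge_min lexx.
(* Its [d]-th power is the required singular factor; [M >= 1] lets it absorb the constant term of
   [hK2]. *)
pose M := m `^ (- alpha^-1).
have M1 : 1 <= M.
  rewrite /M powRN -[leLHS]invr1 lef_pV2 ?posrE ?powR_gt0//.
  have -> : 1 = 1 `^ alpha^-1 :> R by rewrite powR1.
  by rewrite ge0_ler_powR ?nnegrE ?invr_ge0 ?(ltW alpha0) ?(ltW m0).
have [p [tau [p0 tE tau0 tau1 mtau]]] := split_time t0.
(* One factor 1/2 comes from [mtau], the other from the square root. *)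
pose b' := k1 / 4 * m; have b'0 : 0 < b' by rewrite mulr_gt0// divr_gt0.
have K3M n : \sum_(i < n) expR (- (b' / d%:R * i%:R `^ alpha)) <= K3 * M.
  apply: le_trans (hK2 _ _ _) _; first exact: divr_gt0.
  rewrite /K3 -mulrA ler_wpM2l ?(ltW K20)// mulrDl mul1r lerD//.
  have kd0 : 0 <= k1 / 4 / d%:R by rewrite divr_ge0// divr_ge0// ltW.
  by rewrite /b' mulrAC /M -powRM// ltW.
have CE : 4 * K * (2 * K3) ^+ d * d%:R ^+ d / m `^ (d%:R / alpha) =
    4 * K * (2 * (K3 * M)) ^+ d * d%:R ^+ d.
  have -> : (m `^ (d%:R / alpha))^-1 = M ^+ d.
    by rewrite -powRN -powR_mulrn ?powR_ge0// -powRrM mulNr mulrC.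
  by rewrite [2 * (K3 * M)]mulrA [(2 * K3 * M) ^+ d]exprMn; ring.
have KM0 : 0 <= K3 * M by rewrite mulr_ge0 ?powR_ge0// ltW.
have C0 : 0 <= 4 * K * (2 * (K3 * M)) ^+ d * d%:R ^+ d.
  apply: mulr_ge0; last exact: exprn_ge0.
  by apply: mulr_ge0; [exact/mulr_ge0/ltW|exact/exprn_ge0/mulr_ge0].
rewrite CE; apply: ge_ereal_sup => _ [f [mf f1] <-].
(* The norm is an essential supremum if the total measure is positive and 0 otherwise. In the first
   case the bound is proved at every [x]. *)
rewrite unlock; case: ifPn => [_|_]; last first.
  by [].
apply/ess_sup_inf.ess_supP; apply: aeW => x; rewrite /= /ou_semigroup.
have mX : measurable_fun setT (X x t) by apply: ou_measurable (hX x) _ _; exact: ltW.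
have hcf (xi : 'cV[R]_d) y :
    `|\int[P]_w cos (dotp xi (X x t w) - y)| <= K * expR (- (b' * `|xi| `^ alpha)).
  have := ou_cos_sqr_le hL alpha0 c10 decay (hX x) xi y tau0 tau1 p0.
  rewrite -tE -/k1 -real_normK ?num_real// => h.
  have e0 : 0 <= K * expR (- (b' * `|xi| `^ alpha)) by rewrite mulr_ge0 ?expR_ge0.
  rewrite -(ler_pXn2r (n := 2)) ?nnegrE//; apply: (le_trans h).
  rewrite /K -expRD -expRM_natl ler_expR; set q := `|xi| `^ alpha.
  have q0 : 0 <= q by exact: powR_ge0.
  have : 0 <= (1 - tau) * c2 by rewrite mulr_ge0// subr_ge0.
  have : 0 <= (tau - m / 2) * (k1 * q).
    by rewrite mulr_ge0 ?subr_ge0// mulr_ge0// ltW.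
  by rewrite /b'; lra.
have dom := law_dominated mX hd alpha0 K0 b'0 KM0 hcf K3M.
apply: le_trans (expectation_le_norm1 mX C0 dom mf) _.
by rewrite -[leRHS]mule1; apply: lee_wpmul2l.
Qed.
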